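(* Let $\gamma>1$ and $0<u_1\le 1/\gamma^4<1\le u_2<\infty$. Every extremal trajectory of the time-optimal problem described in the context (transfer from $(1,0)$ to $(\gamma,0)$) has either the form $XYX\ldots XY$ (starting with an $X$-segment, ending with a $Y$-segment), with an odd number of switchings, or the form $YXY\ldots XY$ (starting and ending with a $Y$-segment), with an even number of switchings. Put $$c_1=u_1+1,\qquad c_2=u_2+1,\qquad c=u_2\gamma^2+\frac{1}{\gamma^2},$$ and, for a number $s>0$, $$T_X=\frac{1}{2\sqrt{u_1}}\cos^{-1}\left(\frac{s-u_1}{s+u_1}\right),\qquad T_Y=\frac{1}{2\sqrt{u_2}}\left(2\pi-\cos^{-1}\left(\frac{s-u_2}{s+u_2}\right)\right),$$ $$T_F=\frac{1}{2\sqrt{u_2}}\cos^{-1}\left(\frac{-sc+u_2\sqrt{c^2-4(s+u_2)}}{(s+u_2)\sqrt{c^2-4u_2}}\right).$$ (i) The time needed to reach the target point $(\gamma,0)$ with an extremal of the form $XYX\ldots XY$ with $2n+1$ switchings, $n=0,1,2,\ldots$, is, for one of the two choices of sign (upper signs throughout or lower signs throughout), $$T^{\pm}_{2n+1}=T^{\pm}_{I,1}+n(T_X+T_Y)+T_F,$$ where $$T^{\pm}_{I,1}=\frac{1}{2\sqrt{u_1}}\cos^{-1}\left(\frac{sc_1\mp u_1\sqrt{c_1^2-4(s+u_1)}}{(s+u_1)\sqrt{c_1^2-4u_1}}\right)$$ and $s$ is a solution of the transcendental equation $$\frac{c+\sqrt{c^2-4(s+u_2)}}{c_1\pm\sqrt{c_1^2-4(s+u_1)}}=\left(\frac{s+u_2}{s+u_1}\right)^{n+1}$$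 in the interval $0<s\le\min\{(1-u_1)^2/4,\ (u_2\gamma^2-1/\gamma^2)^2/4\}$. (ii) The time needed to reach the target point $(\gamma,0)$ with an extremal of the form $YXY\ldots XY$ with $2n$ switchings, $n=1,2,\ldots$, is, for one of the two choices of sign (upper signs throughout or lower signs throughout), $$T^{\pm}_{2n}=T^{\pm}_{I,2}+nT_X+(n-1)T_Y+T_F,$$ where $$T^{\pm}_{I,2}=\frac{1}{2\sqrt{u_2}}\cos^{-1}\left(\frac{-sc_2\pm u_2\sqrt{c_2^2-4(s+u_2)}}{(s+u_2)\sqrt{c_2^2-4u_2}}\right)$$ and $s$ is a solution of the transcendental equation $$\frac{c+\sqrt{c^2-4(s+u_2)}}{c_2\mp\sqrt{c_2^2-4(s+u_2)}}=\left(\frac{s+u_2}{s+u_1}\right)^{n}$$ in the interval $0<s\le(u_2-1)^2/4$.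
   Context: Control system on $\mathcal D=\{(x_1,x_2)\in\mathbb R^2: x_1>0\}$: $$\dot x_1=x_2,\qquad \dot x_2=-u x_1+\frac{1}{x_1^3}.$$ The parameters satisfy $\gamma>1$ and $0<u_1\le 1/\gamma^4<1\le u_2<\infty$. Admissible controls are Lebesgue measurable functions $u:[0,T]\to[u_1,u_2]$. A controlled trajectory is a pair $(x,u)$ of an admissible control and a corresponding solution. Time-optimal problem: find an admissible control steering $(x_1(0),x_2(0))=(1,0)$ to $(x_1(T),x_2(T))=(\gamma,0)$ in minimum time $T$. Control Hamiltonian: $H(\lambda_0,\lambda,x,u)=\lambda_0+\lambda_1x_2+\lambda_2\left(\frac1{x_1^3}-x_1u\right)$, with $\lambda_0$ a constant and $\lambda=(\lambda_1,\lambda_2)$ a row vector. An extremal of the problem is a controlled trajectory $(x,u)$ on $[0,T]$ from $(1,0)$ to $(\gamma,0)$ for which there exist a constant $\lambda_0\le0$ and a nonzero absolutely continuous $\lambda(t)$ such that (1) $\dot\lambda=-\partial H/\partial x$ along $(x,u)$, i.e. $\dot\lambda_1=\lambda_2(u+3/x_1^4)$, $\dot\lambda_2=-\lambda_1$; (2) for (almost every) $t\in[0,T]$, $v\mapsto H(\lambda_0,\lambda(t),x(t),v)$ attains its maximum over $[u_1,u_2]$ at $v=u(t)$; (3) $H(\lambda_0,\lambda(t),x(t),u(t))\equiv0$. An $X$-segment (resp. $Y$-segment) is a piece of trajectory along which $u\equiv u_1$ (resp. $u\equiv u_2$). A word such as $XYXY$ denotes the concatenation, in this order, of such segments; a switching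 is a time in $(0,T)$ at which the control changes from one of the values $u_1,u_2$ to the other. $\cos^{-1}$ is the inverse cosine with range $[0,\pi]$. *)

(* Defs.v *)
From HB Require Import structures.
From mathcomp Require Import all_boot all_order all_algebra.
From mathcomp Require Import all_classical all_reals all_analysis.
From mathcomp Require Import measurable_realfun.

Set Implicit Arguments.
Unset Strict Implicit.
Unset Printing Implicit Defensive.

Import Order.TTheory GRing.Theory Num.Theory.
Import numFieldNormedType.Exports.

Local Open Scope classical_set_scope.
Local Open Scope ring_scope.

Definition absolutely_continuous (R : realType) (a b : R) (f : R -> R) : Prop :=
  forall e : R, 0 < e -> exists2 d : R, 0 < d &
    forall (n : nat) (l r : 'I_n -> R),
      (forall i, a <= l i /\ l i <= r i /\ r i <= b) ->
      trivIset setT (fun i => `]l i, r i[%classic) ->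
      \sum_(i < n) (r i - l i) < d ->
      \sum_(i < n) `|f (r i) - f (l i)| < e.

(* measurableTypeR carries the Borel sigma-algebra; this type carries its
   completion, i.e. the Lebesgue sigma-algebra. *)
Definition lebesgueTypeR (R : realType) :=
  g_sigma_algebraType (completed_algebra_gen (@lebesgue_measure R)).

Definition lebesgue_measurable_fun (R : realType) (D : set R) (f : R -> R) :
    Prop :=
  measurable_fun (D : set (lebesgueTypeR R)) (f : lebesgueTypeR R -> R).

(* Functions of time are total functions R -> R of which only the values on
   [0, T] matter; the endpoints, where the two-sided derivative depends on the
   values outside [0, T], are negligible. *)
Definition ae_on (R : realType) (T : R) (P : R -> Prop) : Prop :=
  {ae (@lebesgue_measure R), forall t, 0 <= t <= T -> P t}.

Definition admissible_control (R : realType) (u1 u2 T : R) (u : R -> R) : Prop :=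
  lebesgue_measurable_fun `[0, T]%classic u /\
  forall t : R, 0 <= t <= T -> u1 <= u t <= u2.

(* Caratheodory solution staying in x1 > 0. *)
Definition solution (R : realType) (T : R) (x1 x2 u : R -> R) : Prop :=
  [/\ absolutely_continuous 0 T x1,
      absolutely_continuous 0 T x2,
      (forall t, 0 <= t <= T -> 0 < x1 t),
      ae_on T (fun t => is_derive t (1 : R) x1 (x2 t))
    & ae_on T (fun t =>
        is_derive t (1 : R) x2 (- u t * x1 t + (x1 t ^+ 3)^-1))].

Definition controlled_trajectory (R : realType) (u1 u2 T : R)
    (x1 x2 u : R -> R) : Prop :=
  admissible_control u1 u2 T u /\ solution T x1 x2 u.

Definition hamiltonian (R : realType) (l0 l1 l2 x1 x2 v : R) : R :=
  l0 + l1 * x2 + l2 * ((x1 ^+ 3)^-1 - x1 * v).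

Definition adjoint_equation (R : realType) (T : R) (x1 u l1 l2 : R -> R) :
    Prop :=
  ae_on T (fun t =>
    is_derive t (1 : R) l1 (l2 t * (u t + 3 / x1 t ^+ 4))) /\
  ae_on T (fun t => is_derive t (1 : R) l2 (- l1 t)).

(* Controls are determined up to null sets, so the maximum condition and
   H = 0 are required almost everywhere. *)
Definition extremal (R : realType) (gamma u1 u2 T : R) (x1 x2 u : R -> R) :
    Prop :=
  [/\ 0 <= T,
      controlled_trajectory u1 u2 T x1 x2 u,
      (x1 0 = 1 /\ x2 0 = 0),
      (x1 T = gamma /\ x2 T = 0)
    & exists (l0 : R) (l1 l2 : R -> R),
      [/\ l0 <= 0,
          (absolutely_continuous 0 T l1 /\ absolutely_continuous 0 T l2) /\
          (exists t, 0 <= t <= T /\ (l1 t, l2 t) <> (0, 0)),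
          adjoint_equation T x1 u l1 l2,
          ae_on T (fun t => forall v : R, u1 <= v <= u2 ->
            hamiltonian l0 (l1 t) (l2 t) (x1 t) (x2 t) v <=
            hamiltonian l0 (l1 t) (l2 t) (x1 t) (x2 t) (u t))
        & ae_on T (fun t =>
            hamiltonian l0 (l1 t) (l2 t) (x1 t) (x2 t) (u t) = 0)]].

Inductive segment := segX | segY.

Definition segment_control (R : realType) (u1 u2 : R) (a : segment) : R :=
  if a is segX then u1 else u2.

(* u is the concatenation of the segments of w on the consecutive intervals
   (tau i, tau (i + 1)); for an alternating word w the switchings are
   tau 1, ..., tau (size w - 1). *)
Definition has_form (R : realType) (u1 u2 T : R) (u : R -> R)
    (w : seq segment) : Prop :=
  exists tau : nat -> R,
    [/\ tau 0%N = 0,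
        tau (size w) = T,
        (forall i, (i < size w)%N -> tau i < tau i.+1)
      & forall i, (i < size w)%N ->
          {ae (@lebesgue_measure R), forall t, tau i < t < tau i.+1 ->
             u t = segment_control u1 u2 (nth segX w i)}].

(* 2n+1 switchings *)
Definition word_XY (n : nat) : seq segment := flatten (nseq n.+1 [:: segX; segY]).

(* 2n switchings *)
Definition word_YXY (n : nat) : seq segment :=
  segY :: flatten (nseq n [:: segX; segY]).

Definition c_init (R : realType) (u : R) : R := u + 1.

Definition c_fin (R : realType) (gamma u2 : R) : R :=
  u2 * gamma ^+ 2 + (gamma ^+ 2)^-1.

Definition time_X (R : realType) (u1 s : R) : R :=
  (2 * Num.sqrt u1)^-1 * acos ((s - u1) / (s + u1)).

Definition time_Y (R : realType) (u2 s : R) : R :=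
  (2 * Num.sqrt u2)^-1 * (2 * pi - acos ((s - u2) / (s + u2))).

Definition time_F (R : realType) (gamma u2 s : R) : R :=
  let c := c_fin gamma u2 in
  (2 * Num.sqrt u2)^-1 *
  acos ((- s * c + u2 * Num.sqrt (c ^+ 2 - 4 * (s + u2))) /
        ((s + u2) * Num.sqrt (c ^+ 2 - 4 * u2))).

(* In the four definitions below, sg = 1 selects the upper signs and
   sg = -1 the lower ones. *)
Definition time_I1 (R : realType) (u1 sg s : R) : R :=
  let c1 := c_init u1 in
  (2 * Num.sqrt u1)^-1 *
  acos ((s * c1 - sg * (u1 * Num.sqrt (c1 ^+ 2 - 4 * (s + u1)))) /
        ((s + u1) * Num.sqrt (c1 ^+ 2 - 4 * u1))).

Definition time_I2 (R : realType) (u2 sg s : R) : R :=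
  let c2 := c_init u2 in
  (2 * Num.sqrt u2)^-1 *
  acos ((- s * c2 + sg * (u2 * Num.sqrt (c2 ^+ 2 - 4 * (s + u2)))) /
        ((s + u2) * Num.sqrt (c2 ^+ 2 - 4 * u2))).

Definition transcendental_XY (R : realType) (gamma u1 u2 sg s : R) (n : nat) :
    Prop :=
  let c1 := c_init u1 in
  let c := c_fin gamma u2 in
  (c + Num.sqrt (c ^+ 2 - 4 * (s + u2))) /
  (c1 + sg * Num.sqrt (c1 ^+ 2 - 4 * (s + u1))) =
  ((s + u2) / (s + u1)) ^+ n.+1.

Definition transcendental_YXY (R : realType) (gamma u1 u2 sg s : R) (n : nat) :
    Prop :=
  let c2 := c_init u2 in
  let c := c_fin gamma u2 in
  (c + Num.sqrt (c ^+ 2 - 4 * (s + u2))) /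
  (c2 - sg * Num.sqrt (c2 ^+ 2 - 4 * (s + u2))) =
  ((s + u2) / (s + u1)) ^+ n.

(* Main.v *)
(** On an arc with constant control [v = w ^ 2] the motion linearises: with [c]
    the energy, [q = x1 ^ 2] solves [q'' = 2 c - 4 v q], and the relation [H = 0]
    makes [mu = l2 x1], where [l2] is the second costate component, solve the
    analogous [mu'' = 2 l0 - 4 v mu].  The costate
    never vanishes, so the zeros of [l2] are simple; hence they are isolated and
    the control is bang-bang with finitely many switchings.  Between consecutive
    zeros of [l2], at distance [phi / w], one gets
    [w cos phi + r sin phi = 0] with [r = x2 / x1] at the start; therefore [r]
    changes sign, [q] becomes [1 / ((s + v) q)] with [s = r ^ 2], and
    [cos (2 phi) = (s - v) / (s + v)].  The first and last arcs start or end at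
    rest, where [H = 0] forces them to last at most half a period.  Composing
    these maps gives the transcendental equations.  A last arc of type [X] is
    impossible because it would have to start with [q >= gamma ^ 2], while
    [q <= 1] at every switching from [Y] to [X].  The abnormal extremals are
    those with [s = 0]; they overshoot the target. *)

Require Import Defs.
From mathcomp Require Import all_boot all_order all_algebra.
From mathcomp Require Import all_classical all_reals all_analysis.
From mathcomp Require Import measurable_realfun ring lra.
Import Order.TTheory GRing.Theory Num.Theory.
Import numFieldNormedType.Exports.

Set Implicit Arguments.
Unset Strict Implicit.
Unset Printing Implicit Defensive.

Local Open Scope classical_set_scope.
Local Open Scope ring_scope.

(** The data are of Caratheodory type: derivatives, the maximum condition and [H = 0] hold only
    almost everywhere. Absolute continuity turns almost-everywhere bounds on a derivative into
    bounds on increments; where the control is almost everywhere constant the right-hand sides are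
    continuous, so the equations hold at every interior time and classical calculus applies. The
    induction along an interval that proves this also yields the finitely many switchings, in place
    of a compactness argument. At a switching [H = 0] reads [l1 x2 = - l0 >= 0]. This fixes the sign
    of [r] there and decides between the two angles with the same [cos (2 phi)]; hence [acos] in
    [time_X] and [2 pi - acos] in [time_Y]. Given [s], the value of [q] at the first switching is a
    root of [(s + v) q ^ 2 - c q + 1], with [c] the energy of the first arc. The two roots give the
    two signs in the initial time. At the last switching only the larger root is possible, so
    [time_F] has a single sign. *)

(** * Induction along an interval and error bounds for derivatives *)

Lemma interval_induction (R : realType) (P : R -> Prop) (a b : R) :
  a <= b -> P a ->
  (forall t : R, a <= t <= b -> exists2 e : R, 0 < e &
     forall t1 t2 : R, t - e < t1 -> t1 <= t -> t <= t2 -> t2 < t + e ->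
       a <= t1 -> t2 <= b -> P t1 -> P t2) ->
  P b.
Proof.
move=> ab Pa H.
pose S : set R := [set t | a <= t <= b /\ P t].
have Sa : S a by rewrite /S /= lexx ab.
have Sub : ubound S b by move=> t; rewrite /S /= => -[/andP[]].
have hS : has_sup S by split; [exists a | exists b].
have sa : a <= sup S by apply: ub_le_sup => //; exists b.
have sb : sup S <= b by apply: ge_sup => //; exists a.
(* The supremum need not belong to [S]: the hypothesis at [sup S] carries [P] from an element of [S]
   just below it to a point just above it, or to [b]. *)
have [e e0 He] := H (sup S) (introT andP (conj sa sb)).
have [t [/andP[ta tb] Pt] lt_t] := sup_adherent e0 hS.
have ts : t <= sup S by apply: ub_le_sup; [exists b | rewrite /S /= ta tb].
have := He t (Num.min b (sup S + e / 2)) lt_t ts.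
rewrite le_min sb /= gt_min ge_min lexx /= => /(_ _ _ ta isT Pt) Pm.
have {}Pm : P (Num.min b (sup S + e / 2)).
  by apply: Pm; [lra | apply/orP; right; lra].
case: (lerP b (sup S + e / 2)) Pm => // lt_sb Ps.
suff : sup S + e / 2 <= sup S by lra.
by apply: ub_le_sup; [exists b | split=> //; lra].
Qed.

Lemma is_derive_bound (R : realType) (f : R -> R) (x df e : R) :
  is_derive x 1 f df -> 0 < e ->
  exists2 d : R, 0 < d & forall y : R, `|y - x| < d ->
    `|f y - f x - df * (y - x)| <= e * `|y - x|.
Proof.
case=> /cvg_ex[l Hl] fdf e0.
have ldf : l = df by rewrite -fdf; apply/esym/cvg_lim.
rewrite {}ldf in Hl.
move/cvgrPdist_le : Hl => /(_ _ e0).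
rewrite near_withinE near_simpl => /nbhs_ballP[d d0 Hd].
exists d => // y yx.
have [->|yNx] := eqVneq y x; first by rewrite !subrr mulr0 subrr !normr0 mulr0.
have yx0 : y - x != 0 by rewrite subr_eq0.
have /Hd : ball (0 : R) d (y - x) by rewrite /ball /= sub0r normrN.
move=> /(_ yx0) /=.
rewrite -[_%:A]/((y - x) * 1) mulr1 subrK -[_ *: _]/(_ * _).
rewrite -(ler_pM2r (x := `|y - x|)) ?normr_gt0// -normrM mulrBl.
by rewrite mulrAC mulVf// mul1r distrC.
Qed.

Lemma is_derive_of_bound (R : realType) (f : R -> R) (x df : R) :
  (forall e : R, 0 < e ->
     exists2 d : R, 0 < d & forall y : R, `|y - x| < d ->
       `|f y - f x - df * (y - x)| <= e * `|y - x|) ->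
  is_derive x 1 f df.
Proof.
move=> H.
have Hl : h^-1 *: (f (h *: (1 : R) + x) - f x) @[h --> (0 : R)^'] --> df.
  apply/cvgrPdist_le => e e0.
  have [d d0 Hd] := H _ e0.
  rewrite near_withinE near_simpl; apply/nbhs_ballP; exists d => // h.
  rewrite /ball /= sub0r normrN => hd h0.
  rewrite -[_%:A]/(h * 1) mulr1 -[_ *: _]/(_ * _).
  have := Hd (h + x); rewrite addrK => /(_ hd).
  have <- : (h^-1 * (f (h + x) - f x) - df) * h = f (h + x) - f x - df * h.
    by rewrite mulrBl mulrAC mulVf// mul1r.
  by rewrite normrM distrC ler_pM2r// normr_gt0.
by split; [apply/cvg_ex; exists df | apply/cvg_lim].
Qed.

(** * Absolutely continuous functions *)

Lemma null_open_cover (R : realType) (N : set R) (e : R) :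
  (@lebesgue_measure R).-negligible N -> 0 < e ->
  exists U : set R, [/\ open U, N `<=` U & (lebesgue_measure U < e%:E)%E].
Proof.
move=> [A [mA A0 NA]] e0.
have [|U [oU AU UA]] := @lebesgue_regularity_outer R A e mA _ e0.
  by rewrite [X in (X < _)%E]A0 ltry.
exists U; split=> //; first exact: subset_trans AU.
apply: le_lt_trans UA.
rewrite -[leRHS]adde0 -[X in (_ + X)%E]A0.
have UE : U = (U `\` A) `|` A.
  by apply/seteqP; split=> [t Ut|t [[]|/AU]//]; have [?|?] := pselect (A t);
      [right|left].
have mU : measurable U by exact: open_measurable.
by rewrite {1}UE; apply: measureU2 => //; exact: measurableD.
Qed.

Lemma ae_neq (R : realType) (a : R) : {ae (@lebesgue_measure R), forall t, t <> a}.
Proof.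
exists [set a]; split=> //; first exact: lebesgue_measure_set1.
by move=> t /= /contrapT.
Qed.

Lemma sum_itv_le_measure (R : realType) (U : set R) (n : nat) (l r : 'I_n -> R) :
  open U -> (forall i, l i <= r i) -> (forall i, `]l i, r i[ `<=` U) ->
  trivIset setT (fun i => `]l i, r i[%classic) ->
  ((\sum_(i < n) (r i - l i))%:E <= lebesgue_measure U)%E.
Proof.
move=> oU lr sU tI.
have mI i : measurable (`]l i, r i[%classic : set R) by [].
have -> : (\sum_(i < n) (r i - l i))%:E =
    (\sum_(i < n) lebesgue_measure (`]l i, r i[%classic : set R))%E.
  rewrite -sumEFin; apply: eq_bigr => i _; rewrite lebesgue_measure_itv /=.
  rewrite lte_fin; case: ltP => // rl.
  by have /eqP -> : r i == l i; rewrite ?subrr // eq_le lr rl.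
rewrite -measure_semi_additive_ord//; last exact: bigsetU_measurable.
apply: le_measure; rewrite ?inE; first exact: bigsetU_measurable.
  exact: open_measurable.
by elim/big_ind : _ => // A B AU BU t [/AU|/BU].
Qed.

(* The null set of exceptional times is covered by an open set of small measure.
   Interval induction tiles [[a, b]] with small intervals around good times, where
   the derivative controls the increment, and small intervals inside the cover,
   where absolute continuity does. *)
Lemma ac_ge_linear (R : realType) (a0 b0 a b m : R) (f : R -> R) :
  absolutely_continuous a0 b0 f -> a0 <= a -> a <= b -> b <= b0 ->
  {ae (@lebesgue_measure R), forall t, a < t < b ->
     exists2 D, is_derive t 1 f D & m <= D} ->
  m * (b - a) <= f b - f a.
Proof.
move=> acf a0a ab bb0 Hae.
suff key (h : R) : 0 < h ->
    (m - h) * (b - a) - h * (1 + `|m|) <= f b - f a.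
  apply/ler_addgt0Pr => e e0.
  pose K := (b - a) + (1 + `|m|).
  have K0 : 0 < K by rewrite /K; have := normr_ge0 m; lra.
  have := key (e / K) (divr_gt0 e0 K0).
  have : e / K * K = e by rewrite divfK// gt_eqF.
  by rewrite /K => E1 E2; nra.
move=> h0.
have [d d0 Hd] := acf _ h0.
have dh0 : 0 < Num.min d h by rewrite lt_min d0.
(* The endpoints join the exceptional set, since nothing is assumed about the derivative there. *)
have Hae2 : {ae (@lebesgue_measure R), forall t, [/\ t <> a, t <> b &
    a < t < b -> exists2 D, is_derive t 1 f D & m <= D]}.
  apply: (@filterS3 _ _ (ae_filter_ringOfSetsType lebesgue_measure)) (ae_neq a)
      (ae_neq b) Hae.
  by move=> t H1 H2 H3; split.
(* Measure below [d] keeps the total increment of [f] over the covered pieces below [h]; measure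
   below [h] keeps their total length below [h]. *)
have [U [oU NU Ud]] := null_open_cover Hae2 dh0.
(* The invariant charges the pieces inside [U] to two error terms: the increments of [f] over them
   and [|m|] times their length. Keeping the pieces ordered makes them disjoint at the end. *)
pose P (t : R) := exists (n : nat) (l r : nat -> R),
  [/\ forall i, (i < n)%N -> [/\ a <= l i, l i <= r i & r i <= t],
      forall i, (i < n)%N -> `]l i, r i[ `<=` U,
      forall i j, (i < j < n)%N -> r i <= l j
    & (m - h) * (t - a) - \sum_(i < n) `|f (r i) - f (l i)|
        - `|m| * \sum_(i < n) (r i - l i) <= f t - f a].
have : P b.
  apply: (interval_induction (P := P) ab).
    exists 0%N, (fun=> 0), (fun=> 0); split=> //.
    by rewrite !big_ord0 !subrr !mulr0 !subr0.
  move=> t tab.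
  have [[D fD mD]|nD] := pselect (exists2 D, is_derive t 1 f D & m <= D).
    have [e e0 He] := is_derive_bound fD h0.
    exists e => // t1 t2 et1 t1t tt2 t2e at1 t2b [n [l [r [Hlr HU Hord Hs]]]].
    exists n, l, r; split => // [i /Hlr [? ? rt]|]; first by split=> //; lra.
    have : `|f t2 - f t - D * (t2 - t)| <= h * `|t2 - t|.
      by apply: He; rewrite ger0_norm; lra.
    have : `|f t1 - f t - D * (t1 - t)| <= h * `|t1 - t|.
      by apply: He; rewrite ler0_norm; lra.
    rewrite (ger0_norm (x := t2 - t)); last lra.
    rewrite (ler0_norm (x := t1 - t)); last lra.
    rewrite !ler_norml => /andP[_ B1] /andP[B2 _].
    have : m * (t2 - t1) <= D * (t2 - t1) by rewrite ler_wpM2r//; lra.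
    by move: Hs B1 B2; nra.
  have Ut : U t.
    apply: NU => /= -[na nb H]; apply: nD; apply: H.
    case/andP: tab => ta tb; rewrite !lt_neqAle ta tb !andbT.
    by apply/andP; split; apply/eqP => // E; apply: na.
  have /nbhs_ballP [e e0 He] : nbhs t U by exact: open_nbhs_nbhs.
  exists e => // t1 t2 et1 t1t tt2 t2e at1 t2b [n [l [r [Hlr HU Hord Hs]]]].
  exists n.+1, (fun i => if i == n then t1 else l i), (fun i => if i == n then t2
      else r i).
  split.
  - move=> i; rewrite ltnS leq_eqVlt; case: eqP => [_ _|_ /= /Hlr[? ? ?]]; split=>
      //; lra.
  - move=> i; rewrite ltnS leq_eqVlt; case: eqP => [_ _|_ /= /HU//].
    move=> x /=; rewrite in_itv /= => /andP[x1 x2]; apply: He.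
    by rewrite /ball /= ltr_distl; apply/andP; split; lra.
  - move=> i j /andP[ij]; rewrite ltnS leq_eqVlt.
    have [jn _|_ /= jn] := eqVneq j n; last first.
      by rewrite ltn_eqF ?(ltn_trans ij)//; apply: Hord; rewrite ij.
    by rewrite jn in ij; rewrite ltn_eqF//; have [] := Hlr _ ij.
  - rewrite !big_ord_recr /= eqxx.
    have -> : \sum_(i < n) `|f (if i == n :> nat then t2 else r i) -
        f (if i == n :> nat then t1 else l i)| = \sum_(i < n) `|f (r i) - f (l i)|.
      by apply: eq_bigr => i _; rewrite ltn_eqF.
    have -> : \sum_(i < n) ((if i == n :> nat then t2 else r i) -
        (if i == n :> nat then t1 else l i)) = \sum_(i < n) (r i - l i).
      by apply: eq_bigr => i _; rewrite ltn_eqF.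
    have := ler_norm (- (f t2 - f t1)); rewrite normrN.
    have : (m - h) * (t2 - t1) <= `|m| * (t2 - t1).
      by rewrite ler_wpM2r ?subr_ge0; have := ler_norm m; lra.
    by move: Hs; lra.
case=> n [l [r [Hlr HU Hord Hs]]].
pose l' (i : 'I_n) := l i; pose r' (i : 'I_n) := r i.
have lr' i : l' i <= r' i by have [] := Hlr i (ltn_ord i).
have tI : trivIset setT (fun i => `]l' i, r' i[%classic).
  apply/trivIsetP => i j _ _.
  wlog ij : i j / (i < j)%N.
    move=> W ij; have := ij; rewrite neq_ltn => /orP[/W|/W H]; first exact.
    by rewrite setIC; apply: H; rewrite eq_sym.
  move=> _; apply/seteqP; split=> // x [] /=; rewrite !in_itv /= => /andP[_ xr]
      /andP[lx _].
  by have := Hord i j; rewrite ij ltn_ord => /(_ isT); move: xr lx; rewrite /r'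
      /l'; lra.
have : ((\sum_(i < n) (r' i - l' i))%:E <= lebesgue_measure U)%E.
  by apply: sum_itv_le_measure => // i; exact: HU.
move=> /le_lt_trans /(_ Ud); rewrite lte_fin lt_min => /andP[Sd Sh].
have bnd i : a0 <= l' i /\ l' i <= r' i /\ r' i <= b0.
  by have [? ? ?] := Hlr i (ltn_ord i); split; [|split]; rewrite /l' /r'; lra.
have := Hd n l' r' bnd tI Sd.
move: Sh; rewrite /l' /r' => Sh S1.
have : `|m| * (\sum_(i < n) (r i - l i)) <= `|m| * h by rewrite ler_wpM2l// ltW.
by move: Hs; lra.
Qed.

Lemma ac_opp (R : realType) (a b : R) (f : R -> R) :
  absolutely_continuous a b f -> absolutely_continuous a b (fun t => - f t).
Proof.
move=> acf e e0; have [d d0 Hd] := acf e e0; exists d => // n l r H1 H2 H3.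
apply: le_lt_trans (Hd n l r H1 H2 H3); rewrite le_eqVlt; apply/orP; left.
by apply/eqP; apply: eq_bigr => i _; rewrite -opprD normrN.
Qed.

Lemma ac_lipschitz (R : realType) (a b k : R) (f : R -> R) :
  (forall x y, a <= x -> x <= y -> y <= b -> `|f y - f x| <= k * (y - x)) ->
  absolutely_continuous a b f.
Proof.
move=> Hk e e0; pose K := `|k| + 1.
have K0 : 0 < K by rewrite /K; have := normr_ge0 k; lra.
exists (e / K) => [|n l r H1 _ H3]; first by rewrite divr_gt0.
rewrite ltr_pdivlMr// mulrC mulr_sumr in H3; apply: le_lt_trans H3.
apply: ler_sum => i _; have [? [? ?]] := H1 i.
apply: le_trans (Hk _ _ _ _ _) _ => //; apply: ler_wpM2r; first by lra.
by rewrite /K; have := ler_norm k; lra.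
Qed.

Lemma ac_add (R : realType) (a b : R) (f g : R -> R) :
  absolutely_continuous a b f -> absolutely_continuous a b g ->
  absolutely_continuous a b (fun t => f t + g t).
Proof.
move=> acf acg e e0.
have e2 : 0 < e / 2 by rewrite divr_gt0.
have [d d0 Hd] := acf _ e2; have [d' d0' Hd'] := acg _ e2.
exists (Num.min d d') => [|n l r H1 H2]; first by rewrite lt_min d0.
rewrite lt_min => /andP[/(Hd n l r H1 H2) F /(Hd' n l r H1 H2) G].
apply: (@le_lt_trans _ _ (\sum_(i < n) (`|f (r i) - f (l i)| + `|g (r i) - g (l i)|))).
  by apply: ler_sum => i _; rewrite opprD addrACA ler_normD.
by rewrite big_split /=; lra.
Qed.

Lemma ac_mul_bounded (R : realType) (a b M : R) (f g : R -> R) :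
  (forall t, a <= t <= b -> `|f t| <= M) ->
  (forall t, a <= t <= b -> `|g t| <= M) ->
  absolutely_continuous a b f -> absolutely_continuous a b g ->
  absolutely_continuous a b (fun t => f t * g t).
Proof.
move=> bf bg acf acg e e0.
pose K := 2 * (`|M| + 1).
have M0 := normr_ge0 M; have MM := ler_norm M.
have K0 : 0 < K by rewrite /K; lra.
have e2 : 0 < e / K by rewrite divr_gt0.
have [d d0 Hd] := acf _ e2; have [d' d0' Hd'] := acg _ e2.
exists (Num.min d d') => [|n l r H1 H2]; first by rewrite lt_min d0.
rewrite lt_min => /andP[/(Hd n l r H1 H2) F /(Hd' n l r H1 H2) G].
apply: (@le_lt_trans _ _ ((`|M| + 1) * (\sum_(i < n) (`|f (r i) - f (l i)| + `|g (r
    i) - g (l i)|)))).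
  rewrite mulr_sumr; apply: ler_sum => i _; have [? [? ?]] := H1 i.
  have -> : f (r i) * g (r i) - f (l i) * g (l i) =
    (f (r i) - f (l i)) * g (r i) + f (l i) * (g (r i) - g (l i)) by ring.
  apply: le_trans (ler_normD _ _) _; rewrite !normrM mulrDr.
  have gb : `|g (r i)| <= M by apply: bg; lra.
  have fb : `|f (l i)| <= M by apply: bf; lra.
  apply: lerD; last by apply: ler_wpM2r => //; lra.
  by rewrite mulrC; apply: ler_wpM2r => //; lra.
rewrite big_split /=.
have : (`|M| + 1) * (e / K + e / K) = e.
  by rewrite /K; field; apply/eqP; lra.
by move=> E; rewrite -[ltRHS]E ltr_pM2l; lra.
Qed.

Definition clamp (R : realType) (a b t : R) : R := Num.max a (Num.min b t).

Lemma clamp_id (R : realType) (a b t : R) : a <= t <= b -> clamp a b t = t.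
Proof. by move=> /andP[ta tb]; rewrite /clamp (min_idPr tb) (max_idPr ta). Qed.

Lemma clamp_in (R : realType) (a b t : R) : a <= b -> a <= clamp a b t <= b.
Proof. by move=> ab; rewrite /clamp le_max lexx /= ge_max ab ge_min lexx. Qed.

Lemma clamp_lipschitz (R : realType) (a b s t : R) :
  s <= t -> 0 <= clamp a b t - clamp a b s <= t - s.
Proof.
rewrite /clamp => st; rewrite !maxEle !minEle.
by case: (lerP b t) => ?; case: (lerP b s) => ? //=; case: (lerP a b) => //= ?;
  try (case: (lerP a t) => ? //=); try (case: (lerP a s) => ? //=); lra.
Qed.

Lemma ac_clamp_continuous (R : realType) (a b : R) (f : R -> R) :
  a <= b -> absolutely_continuous a b f ->
  continuous (fun t => f (clamp a b t)).
Proof.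
move=> ab acf t; apply/cvgrPdist_lt => e e0.
have [d d0 Hd] := acf _ e0.
have key s1 s2 : s1 <= s2 -> s2 - s1 < d -> `|f (clamp a b s2) - f (clamp a b s1)| < e.
  move=> s12 sd.
  have /andP[c1 c2] := clamp_lipschitz a b s12.
  have /andP[c3 c4] := clamp_in s1 ab; have /andP[c5 c6] := clamp_in s2 ab.
  have := Hd 1%N (fun=> clamp a b s1) (fun=> clamp a b s2).
  rewrite !big_ord1; apply; last by lra.
    by move=> _; split; [|split]; lra.
  by apply/trivIsetP => i j _ _; rewrite !ord1 eqxx.
apply/nbhs_ballP; exists d => // s; rewrite /ball /= => sd.
have [ts|st] := leP t s.
  by rewrite distrC; apply: key => //; move: sd; rewrite ltr_distl; lra.
by apply: key; move: sd; rewrite ltr_distl; lra.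
Qed.

Lemma ac_le_linear (R : realType) (a0 b0 a b m : R) (f : R -> R) :
  absolutely_continuous a0 b0 f -> a0 <= a -> a <= b -> b <= b0 ->
  {ae (@lebesgue_measure R), forall t, a < t < b ->
     exists2 D, is_derive t 1 f D & D <= m} ->
  f b - f a <= m * (b - a).
Proof.
move=> acf a0a ab bb0 Hae.
have := ac_ge_linear (m := - m) (ac_opp acf) a0a ab bb0.
suff H : {ae (@lebesgue_measure R), forall t, a < t < b ->
    exists2 D, is_derive t 1 (fun t => - f t) D & - m <= D}.
  by move=> /(_ H); lra.
apply: (@filterS _ _ (ae_filter_ringOfSetsType lebesgue_measure)) Hae.
move=> t H /H [D fD Dm]; exists (- D); last by rewrite lerN2.
exact: is_deriveN.
Qed.

(** Near [t] the values of [G] stay within [e] of [G t], so the two linear bounds enclose every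
    difference quotient near [t] between [G t - e] and [G t + e], whether or not [t] itself is
    exceptional. *)
Lemma ac_is_derive (R : realType) (a0 b0 a b : R) (f G : R -> R) :
  absolutely_continuous a0 b0 f -> a0 <= a -> b <= b0 -> continuous G ->
  {ae (@lebesgue_measure R), forall t, a < t < b -> is_derive t 1 f (G t)} ->
  forall t, a < t < b -> is_derive t 1 f (G t).
Proof.
move=> acf a0a bb0 cG Hae t /andP[ta tb].
apply: is_derive_of_bound => e e0.
have /cvgrPdist_le /(_ e e0) /nbhs_ballP[d d0 Hd] := cG t.
pose d' := Num.min d (Num.min (t - a) (b - t)).
have d'0 : 0 < d' by rewrite !lt_min; apply/and3P; split=> //; lra.
have dd : d' <= d by rewrite ge_min lexx.
have d1 : d' <= t - a by rewrite !ge_min lexx !orbT.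
have d2 : d' <= b - t by rewrite !ge_min lexx !orbT.
have key p q : p <= q -> t - d' < p -> q < t + d' ->
    (G t - e) * (q - p) <= f q - f p <= (G t + e) * (q - p).
  move=> pq tp qt.
  have Gb s : p < s < q -> `|G t - G s| <= e.
    by move=> /andP[ps sq]; apply: Hd; rewrite /ball /= ltr_distl; lra.
  apply/andP; split.
    apply: (ac_ge_linear (a0 := a0) (b0 := b0)) => //; try lra.
    apply: (@filterS _ _ (ae_filter_ringOfSetsType lebesgue_measure)) Hae.
    move=> s H spq; exists (G s); first by apply: H; lra.
    by have := Gb s spq; rewrite ler_norml; lra.
  apply: (ac_le_linear (a0 := a0) (b0 := b0)) => //; try lra.
  apply: (@filterS _ _ (ae_filter_ringOfSetsType lebesgue_measure)) Hae.
  move=> s H spq; exists (G s); first by apply: H; lra.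
  by have := Gb s spq; rewrite ler_norml; lra.
exists d' => // y; rewrite ltr_distl => yd.
have [ty|yt] := leP t y.
  have [||] := andP (key t y ty _ _); try lra.
  by rewrite (ger0_norm (x := y - t)) ?subr_ge0// ler_norml => *; lra.
have [||] := andP (key y t (ltW yt) _ _); try lra.
by rewrite (ltr0_norm (x := y - t)) ?subr_lt0// ler_norml => *; lra.
Qed.

Lemma ae_exists_itv (R : realType) (p q : R) (Q : R -> Prop) :
  p < q -> {ae (@lebesgue_measure R), forall t, Q t} -> exists t, p < t < q /\ Q t.
Proof.
move=> pq [A [mA A0 QA]]; apply: contrapT => nex.
have sub : `]p, q[ `<=` A.
  move=> t /=; rewrite in_itv /= => tpq; apply: QA => /= Qt; apply: nex.
  by exists t.
have : (lebesgue_measure (`]p, q[%classic : set R) <= lebesgue_measure A)%E.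
  by apply: le_measure; rewrite ?inE.
by rewrite [X in (_ <= X)%E]A0 lebesgue_measure_itv /= lte_fin pq lee_fin; lra.
Qed.

(** A negative value would persist on an interval, which is not negligible. *)
Lemma ae_continuous_ge0 (R : realType) (a b : R) (g : R -> R) :
  a < b -> continuous g ->
  {ae (@lebesgue_measure R), forall t, a < t < b -> 0 <= g t} ->
  forall t, a <= t <= b -> 0 <= g t.
Proof.
move=> ab cg Hae t /andP[ta tb]; rewrite leNgt; apply/negP => gt0.
have gn0 : 0 < - g t by lra.
have /cvgrPdist_lt /(_ _ gn0) /nbhs_ballP[d d0 Hd] := cg t.
have pq : Num.max a (t - d) < Num.min b (t + d).
  by rewrite lt_min !gt_max ab; move: d0 => /= d0; apply/and3P; split; lra.
have [s [/andP[]]] := ae_exists_itv pq Hae.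
rewrite gt_max lt_min => /andP[s1 s2] /andP[s3 s4] /(_ _); rewrite s1 s3 => /(_ isT) gs.
have : `|g t - g s| < - g t by apply: Hd; rewrite /ball /= ltr_distl; lra.
by rewrite ltr_norml; lra.
Qed.

(** * Costates do not vanish *)

(** This rule and the next ones are phrased for functions written as [fun t => ...], with products
    in place of scalings, so that a derivative is assembled by application and its value adjusted
    afterwards by [is_derive_eq]. *)
Lemma is_derive1M (R : realType) (f g : R -> R) (x a b : R) :
  is_derive x 1 f a -> is_derive x 1 g b ->
  is_derive x 1 (fun t => f t * g t) (a * g x + f x * b).
Proof.
move=> fa gb; have H := is_deriveM fa gb; apply: is_derive_eq H _.
by rewrite -![_ *: _]/(_ * _); ring.
Qed.

Lemma is_derive1D (R : realType) (f g : R -> R) (x a b : R) :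
  is_derive x 1 f a -> is_derive x 1 g b ->
  is_derive x 1 (fun t => f t + g t) (a + b).
Proof. exact: is_deriveD. Qed.

Lemma is_derive1B (R : realType) (f g : R -> R) (x a b : R) :
  is_derive x 1 f a -> is_derive x 1 g b ->
  is_derive x 1 (fun t => f t - g t) (a - b).
Proof. exact: is_deriveB. Qed.

Lemma is_derive1Z (R : realType) (f : R -> R) (k x a : R) :
  is_derive x 1 f a -> is_derive x 1 (fun t => k * f t) (k * a).
Proof. by move=> fa; exact: is_deriveZ. Qed.

Lemma is_derive1_cst (R : realType) (k x : R) : is_derive x 1 (fun=> k) 0.
Proof. exact: is_derive_cst. Qed.

Lemma is_derive1V (R : realType) (f : R -> R) (x a : R) : f x != 0 ->
  is_derive x 1 f a -> is_derive x 1 (fun t => (f t)^-1) (- a / f x ^+ 2).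
Proof.
move=> f0 fa; have H := is_deriveV f0 fa; apply: is_derive_eq H _.
by rewrite -[_ *: _]/(_ * _) mulNr mulrC mulNr.
Qed.

Lemma is_derive1_chain (R : realType) (f g : R -> R) (x a b : R) :
  is_derive (g x) 1 f a -> is_derive x 1 g b ->
  is_derive x 1 (fun t => f (g t)) (a * b).
Proof. by move=> fa gb; exact: (is_derive1_comp fa gb). Qed.

Lemma continuous_bounded (R : realType) (a b : R) (f : R -> R) :
  a <= b -> continuous f -> exists M, forall t, a <= t <= b -> `|f t| <= M.
Proof.
move=> ab cf.
have cn : {within `[a, b], continuous (fun t => `|f t|)}.
  apply: continuous_subspaceT => t; apply: continuous_comp; first exact: cf.
  exact: norm_continuous.
have [c _ Hc] := EVT_max ab cn.
by exists `|f c| => t tab; apply: Hc; rewrite in_itv.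
Qed.

Lemma ac_bounded (R : realType) (a b : R) (f : R -> R) :
  a <= b -> absolutely_continuous a b f ->
  exists M, forall t, a <= t <= b -> `|f t| <= M.
Proof.
move=> ab /(ac_clamp_continuous ab) /(continuous_bounded ab)[M HM].
by exists M => t tab; rewrite -{1}(clamp_id tab); exact: HM.
Qed.

Lemma ac_mul (R : realType) (a b : R) (f g : R -> R) :
  a <= b -> absolutely_continuous a b f -> absolutely_continuous a b g ->
  absolutely_continuous a b (fun t => f t * g t).
Proof.
move=> ab acf acg.
have [M HM] := ac_bounded ab acf; have [N HN] := ac_bounded ab acg.
apply: (ac_mul_bounded (M := Num.max M N)) => // t tab.
  by rewrite le_max HM.
by rewrite le_max HN ?orbT.
Qed.

Lemma ac_C1 (R : realType) (a b : R) (f g : R -> R) :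
  a <= b -> (forall t : R, is_derive t 1 f (g t)) -> continuous g ->
  absolutely_continuous a b f.
Proof.
move=> ab df cg; have [M HM] := continuous_bounded ab cg.
apply: (ac_lipschitz (k := M)) => x y ax xy yb.
have cf : {within `[x, y], continuous f}.
  apply: continuous_subspaceT => t; apply: differentiable_continuous.
  by apply/derivable1_diffP; have [] := df t.
have [c] := MVT_segment xy (fun t _ => df t) cf.
rewrite in_itv /= => /andP[xc cy] ->.
rewrite normrM (ger0_norm (x := y - x)) ?subr_ge0// ler_wpM2r ?subr_ge0//.
by apply: HM; lra.
Qed.

Lemma is_derive_expM (R : realType) (M t : R) :
  is_derive t 1 (fun x : R => expR (M * x)) (M * expR (M * t)).
Proof.
apply: is_derive_eq (is_derive1_chain (g := fun x => M * x) (is_derive_expR _)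
    (is_derive1Z _ _)) _.
by rewrite mulr1 mulrC.
Qed.

Lemma continuous_expM (R : realType) (M : R) : continuous (fun x : R => M * expR (M
    * x)).
Proof.
move=> t; apply: differentiable_continuous; apply/derivable1_diffP.
apply: derivableM => //.

Qed.

(** [W t * expR (- M * t)] does not increase, which carries a zero forward in time;
    [W t * expR (M * t)] does not decrease, which carries it backward. *)
Lemma gronwall_zero (R : realType) (T M : R) (W : R -> R) :
  absolutely_continuous 0 T W -> (forall t, 0 <= W t) ->
  {ae (@lebesgue_measure R), forall t, 0 < t < T ->
    exists2 D, is_derive t 1 W D & `|D| <= M * W t} ->
  forall t1 t2, 0 <= t1 <= T -> 0 <= t2 <= T -> W t1 = 0 -> W t2 = 0.
Proof.
move=> acW W0 Hae t1 t2 t1T t2T Wt1; apply/eqP; rewrite eq_le W0 andbT.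
have T0 : 0 <= T by lra.
have acE (m : R) : absolutely_continuous 0 T (fun t => W t * expR (m * t)).
  apply: ac_mul => //; apply: (ac_C1 (g := fun x : R => m * expR (m * x))) => //.
    by move=> t; exact: is_derive_expM.
  exact: continuous_expM.
have dW (t m D : R) : is_derive t 1 W D ->
    is_derive t 1 (fun t => W t * expR (m * t)) ((D + m * W t) * expR (m * t)).
  by move=> dD; apply: is_derive_eq (is_derive1M dD (is_derive_expM _ _)) _; ring.
have [t12|t21] := leP t1 t2.
  have H : {ae (@lebesgue_measure R), forall t, t1 < t < t2 ->
     exists2 D, is_derive t 1 (fun t => W t * expR (- M * t)) D & D <= 0}.
    apply: (@filterS _ _ (ae_filter_ringOfSetsType lebesgue_measure)) Hae.
    move=> t H t12'; have [|D dD] := H; first by lra.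
    rewrite ler_norml => bD; exists ((D + - M * W t) * expR (- M * t)); first exact: dW.
    by rewrite pmulr_lle0 ?expR_gt0//; lra.
  have := ac_le_linear (acE (- M)) _ t12 _ H.
  rewrite mul0r Wt1 mul0r subr0 => /(_ _ _).
  by rewrite pmulr_lle0 ?expR_gt0//; apply; lra.
have H : {ae (@lebesgue_measure R), forall t, t2 < t < t1 ->
     exists2 D, is_derive t 1 (fun t => W t * expR (M * t)) D & 0 <= D}.
  apply: (@filterS _ _ (ae_filter_ringOfSetsType lebesgue_measure)) Hae.
  move=> t H t12'; have [|D dD] := H; first by lra.
  rewrite ler_norml => bD; exists ((D + M * W t) * expR (M * t)); first exact: dW.
  by rewrite pmulr_lge0 ?expR_gt0//; lra.
have := ac_ge_linear (acE M) _ (ltW t21) _ H.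
rewrite mul0r Wt1 mul0r sub0r oppr_ge0 => /(_ _ _).
by rewrite pmulr_lle0 ?expR_gt0//; apply; lra.
Qed.

(** Gronwall for [l1 ^ 2 + l2 ^ 2]: its derivative [2 l1 l2 (k - 1)] is at most [K + 1] times it in
    absolute value. *)
Lemma linear_ode_nonvanishing (R : realType) (T K : R) (k l1 l2 : R -> R) :
  absolutely_continuous 0 T l1 -> absolutely_continuous 0 T l2 ->
  (forall t, 0 <= t <= T -> `|k t| <= K) ->
  {ae (@lebesgue_measure R), forall t, 0 <= t <= T -> is_derive t 1 l1 (l2 t * k t)} ->
  {ae (@lebesgue_measure R), forall t, 0 <= t <= T -> is_derive t 1 l2 (- l1 t)} ->
  forall t1 t2, 0 <= t1 <= T -> 0 <= t2 <= T ->
  (l1 t1, l2 t1) = (0, 0) -> (l1 t2, l2 t2) = (0, 0).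
Proof.
move=> ac1 ac2 kK d1 d2 t1 t2 t1T t2T [z1 z2].
pose W t := l1 t * l1 t + l2 t * l2 t.
have T0 : 0 <= T by lra.
have acW : absolutely_continuous 0 T W.
  by apply: ac_add; apply: ac_mul.
have W0 t : 0 <= W t by rewrite /W addr_ge0// -expr2 sqr_ge0.
have : W t2 = 0.
  apply: (gronwall_zero (M := K + 1) acW W0 _ (t1 := t1)) => //; last first.
    by rewrite /W z1 z2 mulr0 addr0.
  apply: (@filterS2 _ _ (ae_filter_ringOfSetsType lebesgue_measure)) d1 d2.
  move=> t H1 H2 tT; have {}tT : 0 <= t <= T by lra.
  have {}H1 := H1 tT; have {}H2 := H2 tT.
  exists (2 * (l1 t * l2 t) * (k t - 1)).
    apply: is_derive_eq (is_derive1D (is_derive1M H1 H1) (is_derive1M H2 H2)) _.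
    by ring.
  rewrite normrM mulrC; apply: ler_pM => //.
    by apply: le_trans (ler_normB _ _) _; rewrite normr1 lerD2r kK.
  rewrite /W; have := sqr_ge0 (l1 t - l2 t); have := sqr_ge0 (l1 t + l2 t).
  by rewrite ler_norml !expr2; lra.
move/eqP; rewrite /W paddr_eq0 -?expr2 ?sqr_ge0// !sqrf_eq0 => /andP[/eqP-> /eqP->].
by [].
Qed.

Lemma ae_imp (R : realType) (P Q : R -> Prop) :
  {ae (@lebesgue_measure R), forall t, P t} -> (forall t, P t -> Q t) ->
  {ae (@lebesgue_measure R), forall t, Q t}.
Proof.
by move=> aP PQ; apply: (@filterS _ _ (ae_filter_ringOfSetsType lebesgue_measure)) aP.
Qed.

Lemma ae_imp2 (R : realType) (P Q S : R -> Prop) :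
  {ae (@lebesgue_measure R), forall t, P t} ->
  {ae (@lebesgue_measure R), forall t, Q t} -> (forall t, P t -> Q t -> S t) ->
  {ae (@lebesgue_measure R), forall t, S t}.
Proof.
by move=> aP aQ PQS; apply: (@filterS2 _ _ (ae_filter_ringOfSetsType
    lebesgue_measure)) aP aQ.
Qed.

Lemma continuous_const (R : realType) (k : R) : continuous (fun _ : R => k).
Proof. by move=> t; exact: cvg_cst. Qed.

Lemma continuous_add (R : realType) (f g : R -> R) :
  continuous f -> continuous g -> continuous (fun t => f t + g t).
Proof. by move=> cf cg t; apply: cvgD; [exact: cf|exact: cg]. Qed.

Lemma continuous_sub (R : realType) (f g : R -> R) :
  continuous f -> continuous g -> continuous (fun t => f t - g t).
Proof. by move=> cf cg t; apply: cvgB; [exact: cf|exact: cg]. Qed.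

Lemma continuous_mul (R : realType) (f g : R -> R) :
  continuous f -> continuous g -> continuous (fun t => f t * g t).
Proof. by move=> cf cg t; apply: cvgM; [exact: cf|exact: cg]. Qed.

Lemma continuous_inv (R : realType) (f : R -> R) : (forall t, f t != 0) ->
  continuous f -> continuous (fun t => (f t)^-1).
Proof. by move=> f0 cf t; apply: cvgV => //; exact: cf. Qed.

Lemma continuous_expn (R : realType) (f : R -> R) n :
  continuous f -> continuous (fun t => f t ^+ n).
Proof.
move=> cf; elim: n => [|n IHn].
  by have -> : (fun t => f t ^+ 0) = (fun=> 1); [apply/funext => t; rewrite
      expr0|exact: continuous_const].
have -> : (fun t => f t ^+ n.+1) = (fun t => f t * f t ^+ n); last exact:
    continuous_mul.
by apply/funext => t; rewrite exprS.
Qed.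

(** * Regular form of extremals *)

(** The form in which extremals are used from here on: the equations hold at every interior time of
    an interval on which [u] is almost everywhere constant, [H = 0] holds there up to the endpoints,
    and the maximum condition is reduced to the sign of [l2]. The four functions may differ from the
    given ones outside the time interval, which permits continuity on the whole line. *)
Record regular_extremal (R : realType) (gamma u1 u2 T : R)
    (u : R -> R) (l0 : R) (x1 x2 l1 l2 : R -> R) : Prop := RegularExtremal {
  re_T : 0 <= T;
  re_cx1 : continuous x1;
  re_cx2 : continuous x2;
  re_cl1 : continuous l1;
  re_cl2 : continuous l2;
  re_x1_gt0 : forall t, 0 < x1 t;
  re_start : x1 0 = 1 /\ x2 0 = 0;
  re_end : x1 T = gamma /\ x2 T = 0;
  re_l0 : l0 <= 0;
  re_nz : forall t, 0 <= t <= T -> (l1 t, l2 t) <> (0, 0);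
  re_dx1 : forall t, 0 < t < T -> is_derive t 1 x1 (x2 t);
  re_dl2 : forall t, 0 < t < T -> is_derive t 1 l2 (- l1 t);
  re_dx2 : forall v a b, 0 <= a -> a < b -> b <= T ->
    {ae (@lebesgue_measure R), forall t, a < t < b -> u t = v} ->
    forall t, a < t < b -> is_derive t 1 x2 (- v * x1 t + (x1 t ^+ 3)^-1);
  re_dl1 : forall v a b, 0 <= a -> a < b -> b <= T ->
    {ae (@lebesgue_measure R), forall t, a < t < b -> u t = v} ->
    forall t, a < t < b -> is_derive t 1 l1 (l2 t * (v + 3 / x1 t ^+ 4));
  re_H : forall v a b, 0 <= a -> a < b -> b <= T ->
    {ae (@lebesgue_measure R), forall t, a < t < b -> u t = v} ->
    forall t, a <= t <= b -> hamiltonian l0 (l1 t) (l2 t) (x1 t) (x2 t) v = 0;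
  re_max : {ae (@lebesgue_measure R), forall t, 0 <= t <= T ->
    (0 < l2 t -> u t = u1) /\ (l2 t < 0 -> u t = u2)}
}.

Lemma extremal_regular (R : realType) (gamma u1 u2 T : R) (x1 x2 u : R -> R) :
  0 < u1 -> u1 <= u2 -> extremal gamma u1 u2 T x1 x2 u ->
  exists (l0 : R) (y1 y2 l1 l2 : R -> R),
    regular_extremal gamma u1 u2 T u l0 y1 y2 l1 l2.
Proof.
move=> u10 u12 [T0 [[mu ubnd] [acx1 acx2 x1pos dx1 dx2]] [x10 x20] [x1T x2T]].
move=> [l0 [l1 [l2 [l00 [[acl1 acl2] [tz [tzT ltz]]] [dl1 dl2] mx H0]]]].
(* Precomposition with [clamp 0 T] changes nothing on [[0, T]] and makes the four
   functions continuous on the whole line. *)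
pose c := clamp 0 T.
have cin t : 0 <= c t <= T by exact: clamp_in.
have cid t : 0 <= t <= T -> c t = t by exact: clamp_id.
have cx1 : continuous (fun t => x1 (c t)) by exact: ac_clamp_continuous.
have cx2 : continuous (fun t => x2 (c t)) by exact: ac_clamp_continuous.
have cl1 : continuous (fun t => l1 (c t)) by exact: ac_clamp_continuous.
have cl2 : continuous (fun t => l2 (c t)) by exact: ac_clamp_continuous.
have x1c t : 0 < x1 (c t) by exact: x1pos.
have x1c0 t : x1 (c t) != 0 by rewrite gt_eqF.
(* At interior times [c] is locally the identity, so derivatives survive the composition. *)
have trans f (D t : R) : 0 < t < T -> is_derive t 1 f D ->
    is_derive t 1 (fun t => f (c t)) D.
  move=> tT; apply: near_eq_is_derive.
  apply/nbhs_ballP; exists (Num.min t (T - t)); first by rewrite /= lt_min; lra.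
  move=> s; rewrite /ball /= lt_min !ltr_distl => sT.
  by rewrite cid//; lra.
exists l0, (fun t => x1 (c t)), (fun t => x2 (c t)), (fun t => l1 (c t)), (fun t =>
    l2 (c t)).
split=> //.
- by rewrite cid ?lexx.
- by rewrite cid ?lexx ?T0.
- move=> t tT; rewrite cid//.
  (* The coefficient [u + 3 / x1 ^ 4] is only measurable; this continuous majorant provides a
     constant bound for it. *)
  have cK : continuous (fun t => u2 + 3 * (x1 (c t) ^+ 4)^-1).
    apply: continuous_add; first exact: continuous_const.
    apply: continuous_mul; first exact: continuous_const.
    by apply: continuous_inv; [move=> s; rewrite expf_neq0|exact: continuous_expn].
  have [M HM] := continuous_bounded T0 cK.
  move=> lt0; apply: ltz.
  apply: (linear_ode_nonvanishing (K := M) (k := fun t => u t + 3 / x1 t ^+ 4) acl1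
      acl2 _ _ _ tT tzT lt0) => //.
  move=> s sT; have := HM s sT; rewrite cid//.
  have /andP[us1 us2] := ubnd s sT.
  have P : 0 <= 3 / x1 s ^+ 4 by rewrite divr_ge0// exprn_ge0// ltW// x1pos.
  by rewrite !ger0_norm; lra.
- move=> t tT; apply: trans => //.
  apply: (ac_is_derive (G := fun t => x2 (c t)) acx1 (lexx 0) (lexx T)) => //.
  apply: (ae_imp dx1) => s Hs sT; rewrite cid; [apply: Hs|]; lra.
- move=> t tT; apply: trans => //.
  apply: (ac_is_derive (G := fun t => - l1 (c t)) acl2 (lexx 0) (lexx T)) => //.
    by move=> s; apply: cvgN; exact: cl1.
  apply: (ae_imp dl2) => s Hs sT; rewrite cid; [apply: Hs|]; lra.
- move=> v a b a0 ab bT uv t tab; apply: trans; first by lra.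
  apply: (ac_is_derive (G := fun t => - v * x1 (c t) + (x1 (c t) ^+ 3)^-1) acx2 a0
      bT) tab.
    apply: continuous_add; first by apply: continuous_mul => //; exact:
        continuous_const.
    by apply: continuous_inv; [move=> s; rewrite expf_neq0|exact: continuous_expn].
  apply: (ae_imp2 dx2 uv) => s Hs us sab; rewrite cid; last by lra.
  by rewrite -us//; apply: Hs; lra.
- move=> v a b a0 ab bT uv t tab; apply: trans; first by lra.
  apply: (ac_is_derive (G := fun t => l2 (c t) * (v + 3 / (x1 (c t) ^+ 4))) acl1 a0
      bT) tab.
    apply: continuous_mul => //; apply: continuous_add; first exact: continuous_const.
    apply: continuous_mul; first exact: continuous_const.
    by apply: continuous_inv; [move=> s; rewrite expf_neq0|exact: continuous_expn].
  apply: (ae_imp2 dl1 uv) => s Hs us sab; rewrite cid; last by lra.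
  by rewrite -us//; apply: Hs; lra.
- move=> v a b a0 ab bT uv t tab.
  pose g t := hamiltonian l0 (l1 (c t)) (l2 (c t)) (x1 (c t)) (x2 (c t)) v.
  have cg : continuous g.
    apply: continuous_add; first by apply: continuous_add; [exact:
        continuous_const|exact: continuous_mul].
    apply: continuous_mul => //; apply: continuous_sub; last by apply:
        continuous_mul => //; exact: continuous_const.
    by apply: continuous_inv; [move=> s; rewrite expf_neq0|exact: continuous_expn].
  have g0 : {ae (@lebesgue_measure R), forall t, a < t < b -> g t = 0}.
    apply: (ae_imp2 H0 uv) => s Hs us sab; rewrite /g cid; last by lra.
    by rewrite -(us sab); apply: Hs; lra.
  apply/eqP; rewrite eq_le -oppr_ge0; apply/andP; split.
    apply: (ae_continuous_ge0 (g := fun t => - g t) ab) => //.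
      by move=> s; apply: cvgN; exact: cg.
    by apply: (ae_imp g0) => s Hs /Hs ->; rewrite oppr0.
  apply: (ae_continuous_ge0 (g := g) ab) => //.
  by apply: (ae_imp g0) => s Hs /Hs ->.
- apply: (ae_imp mx) => s Hs sT; rewrite cid//.
  have /andP[us1 us2] := ubnd s sT; have xs := x1pos s sT.
  (* Only the term [- l2 x1 v] of the Hamiltonian depends on [v]. *)
  have {}Hs v : u1 <= v <= u2 -> l2 s * x1 s * u s <= l2 s * x1 s * v.
    by move=> /(Hs sT); rewrite /hamiltonian; lra.
  split=> ls.
    apply/eqP; rewrite eq_le us1 andbT.
    by have := Hs u1; rewrite lexx u12 ler_pM2l ?mulr_gt0// => /(_ isT).
  apply/eqP; rewrite eq_le us2 /=.
  by have := Hs u2; rewrite lexx u12 ler_nM2l ?nmulr_rlt0// => /(_ isT).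
Qed.

(** * Switchings *)

Lemma MVT_continuous (R : realType) (f df : R -> R) (p q : R) :
  p < q -> continuous f -> (forall t, p < t < q -> is_derive t 1 f (df t)) ->
  exists2 c, p < c < q & f q - f p = df c * (q - p).
Proof.
move=> pq cf dff.
have df' t : t \in `]p, q[ -> is_derive t 1 f (df t) by rewrite in_itv; exact: dff.
have [c cpq Hc] := MVT pq df' (continuous_subspaceT cf).
by exists c => //; rewrite in_itv in cpq.
Qed.

Lemma continuous_ge0_itv (R : realType) (f : R -> R) (p q : R) :
  p < q -> continuous f -> (forall t, p < t < q -> 0 < f t) ->
  forall t, p <= t <= q -> 0 <= f t.
Proof.
move=> pq cf fp; apply: (ae_continuous_ge0 pq cf).
by apply: aeW => t /fp /ltW.
Qed.

(* In [sgnb], [ctl] and [chain], [true] stands for a [Y]-arc ([u = u2], [l2 < 0])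
   and [false] for an [X]-arc ([u = u1], [0 < l2]). *)
Definition sgnb (R : realType) (b : bool) : R := if b then -1 else 1.

Lemma constant_sign (R : realType) (f : R -> R) (p q : R) :
  p < q -> continuous f -> (forall t, p < t < q -> f t != 0) ->
  exists b, forall t, p < t < q -> 0 < sgnb R b * f t.
Proof.
move=> pq cf f0; pose m := (p + q) / 2.
have mpq : p < m < q by rewrite /m; lra.
exists (f m < 0) => t tpq; rewrite ltNge; apply/negP => H.
have key x y : x <= y -> p < x -> y < q ->
    (f x <= 0 <= f y \/ f y <= 0 <= f x) -> False.
  move=> xy px yq Hxy.
  have H0 : Num.min (f x) (f y) <= 0 <= Num.max (f x) (f y).
    by rewrite ge_min le_max; case: Hxy => /andP[-> ->]; rewrite ?orbT.
  have [c] := IVT xy (continuous_subspaceT cf) H0.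
  by rewrite in_itv /= => cxy fc; have := f0 c; rewrite fc eqxx /=; move=> F; suff
      : false by []; apply: F; lra.
have fm := f0 m mpq.
have Hmt : f m <= 0 <= f t \/ f t <= 0 <= f m.
  move: H; rewrite /sgnb; case: (ltP (f m) 0) => fm0; [left|right]; lra.
have [mt|tm] := leP m t; first by apply: (key m t) => //; lra.
by apply: (key t m); [exact: ltW|lra|lra|case: Hmt; [right|left]].
Qed.

(** At a zero of [l2] the other costate [l1] is nonzero, and [l2' = - l1]: the mean value theorem,
    where [l1] keeps its sign, makes [l2] cross zero. The product form covers both sides of [t] and
    both signs of [l1] at once. *)
Lemma switching_sign (R : realType) (gamma u1 u2 T : R) (u : R -> R) (l0 : R)
    (x1 x2 l1 l2 : R -> R) (t : R) :
  regular_extremal gamma u1 u2 T u l0 x1 x2 l1 l2 ->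
  0 <= t <= T -> l2 t = 0 ->
  exists2 e : R, 0 < e & forall s : R, 0 <= s <= T -> s != t -> `|s - t| < e ->
    l2 s * (s - t) * l1 t < 0.
Proof.
move=> E tT l2t.
have l1t : l1 t != 0.
  by apply/eqP => l1t; apply: (re_nz E tT); rewrite l1t l2t.
have l1p : 0 < `|l1 t| by rewrite normr_gt0.
have c1 : continuous l1 by exact: (re_cl1 E).
have c2 : continuous l2 by exact: (re_cl2 E).
have /cvgrPdist_lt /(_ _ l1p) /nbhs_ballP[e e0 He] := c1 t.
have Hs s : `|s - t| < e -> 0 < l1 s * l1 t.
  move=> st; have : `|l1 t - l1 s| < `|l1 t| by apply: He; rewrite /ball /= distrC.
  have [/gtr0_norm->|] := ltrP 0 (l1 t); first by rewrite ltr_norml; nra.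
  by rewrite le_eqVlt (negbTE l1t) /= => l0'; rewrite (ltr0_norm l0') ltr_norml; nra.
exists e => // s sT st; rewrite ltr_distl => ste.
have [lt_st|lt_ts|/eqP] := ltgtP s t; last by rewrite (negbTE st).
  have [|c cs] := @MVT_continuous R l2 (fun x => - l1 x) s t lt_st c2.
    by move=> x xst; apply: (re_dl2 E); lra.
  have := Hs c; rewrite ltr_distl => /(_ _) P; have {}P : 0 < l1 c * l1 t by apply:
      P; lra.
  rewrite l2t sub0r => /eqP; rewrite eqr_oppLR => /eqP ->.
  have : 0 < (t - s) ^+ 2 by rewrite exprn_gt0 ?subr_gt0.
  by rewrite expr2; nra.
have [|c cs] := @MVT_continuous R l2 (fun x => - l1 x) t s lt_ts c2.
  by move=> x xst; apply: (re_dl2 E); lra.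
have := Hs c; rewrite ltr_distl => /(_ _) P; have {}P : 0 < l1 c * l1 t by apply:
    P; lra.
rewrite l2t subr0 => ->.
have : 0 < (s - t) ^+ 2 by rewrite exprn_gt0 ?subr_gt0.
by rewrite expr2; nra.
Qed.

Lemma switching_isolated (R : realType) (gamma u1 u2 T : R) (u : R -> R) (l0 : R)
    (x1 x2 l1 l2 : R -> R) (t : R) :
  regular_extremal gamma u1 u2 T u l0 x1 x2 l1 l2 -> 0 <= t <= T ->
  exists2 e : R, 0 < e & forall s : R, 0 <= s <= T -> s != t -> `|s - t| < e ->
    l2 s != 0.
Proof.
move=> E tT; have c2 : continuous l2 by exact: (re_cl2 E).
have [l2t|l2t] := eqVneq (l2 t) 0.
  have [e e0 He] := switching_sign E tT l2t; exists e => // s sT st ste.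
  by apply/eqP => l2s; have := He s sT st ste; rewrite l2s !mul0r ltxx.
have l2p : 0 < `|l2 t| by rewrite normr_gt0.
have /cvgrPdist_lt /(_ _ l2p) /nbhs_ballP[e e0 He] := c2 t.
exists e => // s _ _ st; apply/eqP => l2s.
by have : `|l2 t - l2 s| < `|l2 t|; [apply: He; rewrite /ball /= distrC|rewrite l2s
    subr0 ltxx].
Qed.

(* [b] is the type of the first of the [m] alternating arcs, so that the arc on
   [[tau i, tau i.+1]] has type [b (+) odd i]. *)
Record chain (R : realType) (l2 : R -> R) (t : R) (b : bool) (m : nat)
    (tau : nat -> R) : Prop := Chain {
  ch_0 : tau 0%N = 0;
  ch_m : tau m = t;
  ch_lt : forall i, (i < m)%N -> tau i < tau i.+1;
  ch_sgn : forall i, (i < m)%N -> forall s, tau i < s < tau i.+1 ->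
    0 < sgnb R (b (+) odd i) * l2 s;
  ch_z : forall i, (0 < i < m)%N -> l2 (tau i) = 0
}.

Lemma chain_le (R : realType) (l2 : R -> R) t b m tau i j :
  @chain R l2 t b m tau -> (i <= j <= m)%N -> tau i <= tau j.
Proof.
move=> C; elim: j => [|j IHj]; first by rewrite leqn0 => /andP[/eqP->].
rewrite leq_eqVlt => /andP[/orP[/eqP->//|]]; rewrite ltnS => ij jm.
by rewrite (le_trans (IHj _))// ?ij ?(ltnW jm)// ltW// (ch_lt C).
Qed.

Lemma chain_range (R : realType) (l2 : R -> R) t b m tau i :
  @chain R l2 t b m tau -> (i <= m)%N -> 0 <= tau i <= t.
Proof.
move=> C im; apply/andP; split; first by rewrite -(ch_0 C) (chain_le C).
by rewrite -(ch_m C) (chain_le C)// im leqnn.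
Qed.

(** If [l2] does not vanish at the joining time [t > 0], the new piece lengthens the last arc; if it
    does, the piece is a new arc, necessarily of the other type. *)
Lemma chain_step (R : realType) (gamma u1 u2 T : R) (u : R -> R) (l0 : R)
    (x1 x2 l1 l2 : R -> R) (t t' : R) :
  regular_extremal gamma u1 u2 T u l0 x1 x2 l1 l2 -> 0 <= t -> t < t' -> t' <= T ->
  (forall s, t < s < t' -> l2 s != 0) ->
  (exists b m tau, chain l2 t b m tau) -> exists b m tau, chain l2 t' b m tau.
Proof.
move=> E t0 tt' t'T nz [b [m [tau C]]].
have c2 : continuous l2 by exact: (re_cl2 E).
have [b' Hb'] := constant_sign tt' c2 nz.
case: m C => [|m] C.
  have t00 : t = 0 by rewrite -(ch_m C) (ch_0 C).
  exists b', 1%N, (fun i => if i == 0%N then 0 else t'); split=> //.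
  - by case=> // _; rewrite /= -t00.
  - by case=> // _ s; rewrite /= addbF => st; apply: Hb'; rewrite t00.
  - by case=> [|[]].
pose kb := b (+) odd m.
have csg b1 : continuous (fun s => sgnb R b1 * l2 s) by apply: continuous_mul =>
    //; exact: continuous_const.
have ltm : tau m < t by rewrite -(ch_m C) (ch_lt C).
have Hm s : tau m < s < t -> 0 < sgnb R kb * l2 s.
  by rewrite -(ch_m C); exact: (ch_sgn C).
have g1 : 0 <= sgnb R kb * l2 t.
  by apply: (continuous_ge0_itv ltm (csg kb) Hm); rewrite lexx ltW.
have g2 : 0 <= sgnb R b' * l2 t.
  by apply: (continuous_ge0_itv tt' (csg b') Hb'); rewrite lexx ltW.
have taum i : (i <= m)%N -> (i == m.+1) = false by move=> im; rewrite ltn_eqF.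
have [l2t|l2t] := eqVneq (l2 t) 0; last first.
  have kbb : b' = kb.
    move: g1 g2 l2t; case: (b') (kb) => [] [] //=; rewrite /sgnb => H1 H2 /eqP H3;
      exfalso; apply: H3; lra.
  exists b, m.+1, (fun i => if i == m.+1 then t' else tau i); split.
  - exact: (ch_0 C).
  - by rewrite eqxx.
  - move=> i; rewrite ltnS leq_eqVlt => /orP[/eqP->|im].
      by rewrite eqxx ltn_eqF// (lt_trans ltm).
    by rewrite !ltn_eqF// ?(ltn_trans im)//; apply: (ch_lt C); exact: ltnW.
  - move=> i; rewrite ltnS leq_eqVlt => /orP[/eqP->|im].
      rewrite eqxx ltn_eqF// => s /andP[s1 s2].
      have [st|ts|->] := ltgtP s t.
      + by apply: Hm; rewrite s1.
      + by rewrite -/kb -kbb; apply: Hb'; rewrite ts.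
      + by rewrite lt_neqAle g1 andbT eq_sym mulf_neq0// /sgnb; case: (_ (+) _);
          rewrite ?oppr_eq0 oner_eq0.
    by rewrite !ltn_eqF// ?(ltn_trans im)//; apply: (ch_sgn C); exact: ltnW.
  - by move=> i /andP[i0 im]; rewrite ltn_eqF//; apply: (ch_z C); rewrite i0.
(* The zero at [t] is simple, so [l2] changes sign there; it is sampled at [t - d], inside the last
   arc, and at [t + d], inside the new piece. *)
have kbb : b' = ~~ kb.
  have tT : 0 <= t <= T by lra.
  have [e e0 He] := switching_sign E tT l2t.
  pose d := Num.min (e / 2) (Num.min ((t - tau m) / 2) ((t' - t) / 2)).
  have d0 : 0 < d by rewrite /d !lt_min; apply/and3P; split; lra.
  have de : d <= e / 2 by rewrite /d ge_min lexx.
  have d1 : d <= (t - tau m) / 2 by rewrite /d !ge_min lexx ?orbT.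
  have d2 : d <= (t' - t) / 2 by rewrite /d !ge_min lexx ?orbT.
  have tm0 : 0 <= tau m by have /andP[] := chain_range C (leqnSn m).
  have N1 : l2 (t - d) * (t - d - t) * l1 t < 0.
    by apply: He; [lra|apply/eqP; lra|rewrite ltr_distl; lra].
  have N2 : l2 (t + d) * (t + d - t) * l1 t < 0.
    by apply: He; [lra|apply/eqP; lra|rewrite ltr_distl; lra].
  have P1 : 0 < sgnb R kb * l2 (t - d) by apply: Hm; lra.
  have P2 : 0 < sgnb R b' * l2 (t + d) by apply: Hb'; lra.
  have {}N1 : 0 < l2 (t - d) * l1 t.
    have : 0 < d * (l2 (t - d) * l1 t) by lra.
    by rewrite pmulr_rgt0.
  have {}N2 : l2 (t + d) * l1 t < 0.
    have : d * (l2 (t + d) * l1 t) < 0 by lra.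
    by rewrite pmulr_rlt0.
  by move: P1 P2; case: (b') (kb) => [] [] //=; rewrite /sgnb => P1 P2; exfalso; nra.
exists b, m.+2, (fun i => if i == m.+2 then t' else tau i); split.
- exact: (ch_0 C).
- by rewrite eqxx.
- move=> i; rewrite ltnS leq_eqVlt => /orP[/eqP->|im].
    by rewrite eqxx ltn_eqF// (ch_m C).
  by rewrite !ltn_eqF// ?(ltn_trans im)//; apply: (ch_lt C).
- move=> i; rewrite ltnS leq_eqVlt => /orP[/eqP->|im].
    rewrite eqxx ltn_eqF// (ch_m C) /= addbN -/kb -kbb; exact: Hb'.
  by rewrite !ltn_eqF// ?(ltn_trans im)//; apply: (ch_sgn C).
- move=> i /andP[i0]; rewrite ltnS leq_eqVlt => /orP[/eqP->|im].
    by rewrite ltn_eqF// (ch_m C).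
  by rewrite ltn_eqF ?(ltn_trans im)//; apply: (ch_z C); rewrite i0.
Qed.

Lemma chain_exists (R : realType) (gamma u1 u2 T : R) (u : R -> R) (l0 : R)
    (x1 x2 l1 l2 : R -> R) :
  regular_extremal gamma u1 u2 T u l0 x1 x2 l1 l2 ->
  exists b m tau, chain l2 T b m tau.
Proof.
move=> E.
apply: (interval_induction (P := fun t => exists b m tau, chain l2 t b m tau) (re_T E)).
  by exists false, 0%N, (fun=> 0); split=> // i; rewrite ltn0 andbF.
move=> t tT; have [e e0 He] := switching_isolated E tT.
exists e => // t1 t2 et1 t1t tt2 t2e t10 t2T C1.
have C : exists b m tau, chain l2 t b m tau.
  move: (t1t); rewrite le_eqVlt => /orP[/eqP<-//|t1t'].
  apply: (chain_step E t10 t1t' _ _ C1); first by lra.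
  by move=> s st; apply: He; [lra|apply/eqP; lra|rewrite ltr_distl; lra].
move: (tt2); rewrite le_eqVlt => /orP[/eqP<-//|tt2'].
apply: (chain_step E _ tt2' _ _ C) => //; first by lra.
by move=> s st; apply: He; [lra|apply/eqP; lra|rewrite ltr_distl; lra].
Qed.

Definition ctl (R : realType) (u1 u2 : R) (b : bool) : R := if b then u2 else u1.

Lemma chain_control (R : realType) (gamma u1 u2 T : R) (u : R -> R) (l0 : R)
    (x1 x2 l1 l2 : R -> R) b m tau i :
  regular_extremal gamma u1 u2 T u l0 x1 x2 l1 l2 -> chain l2 T b m tau ->
  (i < m)%N ->
  {ae (@lebesgue_measure R), forall t, tau i < t < tau i.+1 ->
    u t = ctl u1 u2 (b (+) odd i)}.
Proof.
move=> E C im; apply: (ae_imp (re_max E)) => t Ht ti.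
have r1 := chain_range C (ltnW im); have r2 := chain_range C im.
have [|H1 H2] := Ht _; first by lra.
have := ch_sgn C im ti; rewrite /ctl /sgnb; case: (_ (+) _) => s; [apply: H2|apply:
    H1]; lra.
Qed.

(** Converse of [chain_control], wanted because [has_form] brings its own division points. The
    maximum condition gives weak signs of [l2] on each arc; a zero inside an arc would be a change
    of sign and is thereby excluded. *)
Lemma control_chain (R : realType) (gamma u1 u2 T : R) (u : R -> R) (l0 : R)
    (x1 x2 l1 l2 : R -> R) b m tau :
  u1 < u2 -> regular_extremal gamma u1 u2 T u l0 x1 x2 l1 l2 ->
  tau 0%N = 0 -> tau m = T -> (forall i, (i < m)%N -> tau i < tau i.+1) ->
  (forall i, (i < m)%N -> {ae (@lebesgue_measure R), forall t,
    tau i < t < tau i.+1 -> u t = ctl u1 u2 (b (+) odd i)}) ->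
  chain l2 T b m tau.
Proof.
move=> u12 E t0 tm tlt tu.
have c2 : continuous l2 by exact: (re_cl2 E).
have mono i j : (i <= j <= m)%N -> tau i <= tau j.
  elim: j => [|j IHj]; first by rewrite leqn0 => /andP[/eqP->].
  rewrite leq_eqVlt => /andP[/orP[/eqP->//|]]; rewrite ltnS => ij jm.
  by rewrite (le_trans (IHj _))// ?ij ?(ltnW jm)// ltW// tlt.
have rng i : (i <= m)%N -> 0 <= tau i <= T.
  by move=> im; rewrite -t0 -tm; apply/andP; split; apply: mono; rewrite ?im ?leqnn.
have csg b1 : continuous (fun s => sgnb R b1 * l2 s) by apply: continuous_mul =>
    //; exact: continuous_const.
have ge0 i : (i < m)%N -> forall s, tau i <= s <= tau i.+1 ->
    0 <= sgnb R (b (+) odd i) * l2 s.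
  move=> im; apply: (ae_continuous_ge0 (tlt i im) (csg _)).
  apply: (ae_imp2 (re_max E) (tu i im)) => s Hs Hu si.
  have r1 := rng i (ltnW im); have r2 := rng i.+1 im.
  have [|H1 H2] := Hs _; first by lra.
  move: (Hu si); rewrite /ctl /sgnb; case: (_ (+) _) => us.
    rewrite mulN1r oppr_ge0 leNgt; apply/negP => /H1; rewrite us => u21.
    by rewrite u21 ltxx in u12.
  rewrite mul1r leNgt; apply/negP => /H2; rewrite us => u21.
  by rewrite u21 ltxx in u12.
split=> //.
- move=> i im s si.
  have g := ge0 i im s; rewrite lt_neqAle g ?andbT; last by lra.
  rewrite eq_sym; apply: mulf_neq0.
    by rewrite /sgnb; case: (_ (+) _); rewrite ?oppr_eq0 oner_eq0.
  apply/eqP => l2s.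
  have r1 := rng i (ltnW im); have r2 := rng i.+1 im.
  have sT : 0 <= s <= T by lra.
  have [e e0 He] := switching_sign E sT l2s.
  pose d := Num.min (e / 2) (Num.min (s - tau i) (tau i.+1 - s)).
  have d0 : 0 < d by rewrite /d !lt_min; apply/and3P; split; lra.
  have de : d <= e / 2 by rewrite /d ge_min lexx.
  have d1 : d <= s - tau i by rewrite /d !ge_min lexx ?orbT.
  have d2 : d <= tau i.+1 - s by rewrite /d !ge_min lexx ?orbT.
  have N1 : l2 (s - d) * (s - d - s) * l1 s < 0.
    by apply: He; [lra|apply/eqP; lra|rewrite ltr_distl; lra].
  have N2 : l2 (s + d) * (s + d - s) * l1 s < 0.
    by apply: He; [lra|apply/eqP; lra|rewrite ltr_distl; lra].
  have P1 := ge0 i im (s - d); have P2 := ge0 i im (s + d).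
  have {}P1 : 0 <= sgnb R (b (+) odd i) * l2 (s - d) by apply: P1; lra.
  have {}P2 : 0 <= sgnb R (b (+) odd i) * l2 (s + d) by apply: P2; lra.
  have {}N1 : 0 < l2 (s - d) * l1 s.
    have : 0 < d * (l2 (s - d) * l1 s) by lra.
    by rewrite pmulr_rgt0.
  have {}N2 : l2 (s + d) * l1 s < 0.
    have : d * (l2 (s + d) * l1 s) < 0 by lra.
    by rewrite pmulr_rlt0.
  have S2 : sgnb R (b (+) odd i) * sgnb R (b (+) odd i) = 1.
    by rewrite /sgnb; case: (_ (+) _); rewrite ?mulrNN mulr1.
  have N3 : (l2 (s - d) * l1 s) * (l2 (s + d) * l1 s) < 0 by rewrite pmulr_rlt0.
  have : 0 <= (sgnb R (b (+) odd i) * sgnb R (b (+) odd i)) * ((l2 (s - d) * l1 s)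
      * (l2 (s + d) * l1 s)).
    by have := mulr_ge0 (mulr_ge0 P1 P2) (sqr_ge0 (l1 s)); rewrite expr2; congr (_
        <= _); ring.
  by rewrite S2 mul1r leNgt N3.
(* Adjacent arcs have opposite types, so their weak inequalities at the common endpoint are
   opposite. *)
- case=> // i /andP[_ im].
  have := ge0 i (ltnW im) (tau i.+1); rewrite lexx ltW ?tlt// 1?ltnW// => /(_ isT).
  have := ge0 i.+1 im (tau i.+1); rewrite lexx ltW ?tlt// => /(_ isT).
  rewrite /= addbN /sgnb; case: (_ (+) _) => /= *; lra.
Qed.

(** * Arcs with constant control *)

Lemma constant_itv (R : realType) (f : R -> R) (a b : R) :
  continuous f -> (forall t, a < t < b -> is_derive t 1 f 0) ->
  forall c s, a <= c <= b -> a <= s <= b -> f s = f c.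
Proof.
move=> cf df c s; wlog : c s / c < s.
  move=> W cab sab; have [cs|sc|->//] := ltgtP c s; first exact: W.
  by apply/esym/W.
move=> cs cab sab.
have [|x _] := @MVT_continuous R f (fun=> 0) c s cs cf; last by rewrite mul0r; lra.
by move=> t tcs; apply: df; lra.
Qed.

(** In place of a uniqueness theorem: [A] and [B] below are the coordinates of [(f - K, g / (2 w))]
    in a frame turning with the phase, and both have zero derivative. *)
Lemma oscillator (R : realType) (f g : R -> R) (a b w k : R) :
  0 < w -> continuous f -> continuous g ->
  (forall t, a < t < b -> is_derive t 1 f (g t)) ->
  (forall t, a < t < b -> is_derive t 1 g (2 * k - 4 * w ^+ 2 * f t)) ->
  forall c s, a <= c <= b -> a <= s <= b ->
  let C := cos (2 * w * (s - c)) in let S := sin (2 * w * (s - c)) in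
  f s = k / (2 * w ^+ 2) + (f c - k / (2 * w ^+ 2)) * C + g c / (2 * w) * S /\
  g s = - (2 * w) * (f c - k / (2 * w ^+ 2)) * S + g c * C.
Proof.
move=> w0 cf cg df dg c s cab sab C S.
have wn0 : w != 0 by rewrite gt_eqF.
set K := k / (2 * w ^+ 2).
pose th t := 2 * w * (t - c).
have dth (t : R) : is_derive t 1 th (2 * w).
  by apply: is_derive_eq (is_derive1Z _ (is_derive1B (is_derive_id t 1)
      (is_derive1_cst c t))) _; rewrite subr0 mulr1.
have cth : continuous th.
  move=> t; apply: differentiable_continuous; apply/derivable1_diffP.
  by have [] := dth t.
have dcos (t : R) : is_derive t 1 (fun t => cos (th t)) (- sin (th t) * (2 * w)).
  by apply: is_derive1_chain (is_derive_cos _) (dth t).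
have dsin (t : R) : is_derive t 1 (fun t => sin (th t)) (cos (th t) * (2 * w)).
  by apply: is_derive1_chain (is_derive_sin _) (dth t).
have ccos : continuous (fun t => cos (th t)).
  by move=> t; apply: continuous_comp; [exact: cth|exact: continuous_cos].
have csin : continuous (fun t => sin (th t)).
  by move=> t; apply: continuous_comp; [exact: cth|exact: continuous_sin].
have cfK : continuous (fun t => f t - K) by apply: continuous_sub => //; exact:
    continuous_const.
have cgw : continuous (fun t => (2 * w)^-1 * g t) by apply: continuous_mul => //;
    exact: continuous_const.
pose A t := (f t - K) * cos (th t) - (2 * w)^-1 * g t * sin (th t).
pose B t := (f t - K) * sin (th t) + (2 * w)^-1 * g t * cos (th t).
have cA : continuous A by apply: continuous_sub; apply: continuous_mul.
have cB : continuous B by apply: continuous_add; apply: continuous_mul.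
have dfK (t : R) : a < t < b -> is_derive t 1 (fun t => f t - K) (g t - 0).
  by move=> tab; apply: is_derive1B (df t tab) (is_derive1_cst _ _).
have dgw (t : R) : a < t < b -> is_derive t 1 (fun t => (2 * w)^-1 * g t)
    ((2 * w)^-1 * (2 * k - 4 * w ^+ 2 * f t)).
  by move=> tab; apply: is_derive1Z; exact: dg.
have dA (t : R) : a < t < b -> is_derive t 1 A 0.
  move=> tab; apply: is_derive_eq (is_derive1B (is_derive1M (dfK t tab) (dcos t))
      (is_derive1M (dgw t tab) (dsin t))) _.
  by rewrite /K; field.
have dB (t : R) : a < t < b -> is_derive t 1 B 0.
  move=> tab; apply: is_derive_eq (is_derive1D (is_derive1M (dfK t tab) (dsin t))
      (is_derive1M (dgw t tab) (dcos t))) _.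
  by rewrite /K; field.
have thc : th c = 0 by rewrite /th subrr mulr0.
have := constant_itv cA dA cab sab; have := constant_itv cB dB cab sab.
rewrite /A /B thc cos0 sin0 !mulr0 !mulr1 subr0 add0r -/(th s) => EB EA.
have CS : cos (th s) ^+ 2 + sin (th s) ^+ 2 = 1 by exact: cos2Dsin2.
rewrite /C /S -/(th s).
have F : f s - K = (f s - K) * (cos (th s) ^+ 2 + sin (th s) ^+ 2) by rewrite CS mulr1.
have G : (2 * w)^-1 * g s = (2 * w)^-1 * g s * (cos (th s) ^+ 2 + sin (th s) ^+ 2)
    by rewrite CS mulr1.
split.
  apply/eqP; rewrite -subr_eq0; apply/eqP.
  rewrite -EA [g c / _]mulrC -EB.
  by move: F; lra.
have -> : g s = 2 * w * ((2 * w)^-1 * g s) by field.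
rewrite G.
have -> : g c = 2 * w * ((2 * w)^-1 * g c) by field.
by rewrite -EA -EB; ring.
Qed.

(** [w] is the square root of the control value, so that [x1 ^ 2] oscillates with angular frequency
    [2 w]. *)
Record arc (R : realType) (w a b l0 : R) (x1 x2 l1 l2 : R -> R) : Prop := Arc {
  arc_lt : a < b;
  arc_cx1 : continuous x1;
  arc_cx2 : continuous x2;
  arc_cl1 : continuous l1;
  arc_cl2 : continuous l2;
  arc_x1_gt0 : forall t, 0 < x1 t;
  arc_dx1 : forall t, a < t < b -> is_derive t 1 x1 (x2 t);
  arc_dx2 : forall t, a < t < b ->
    is_derive t 1 x2 (- w ^+ 2 * x1 t + (x1 t ^+ 3)^-1);
  arc_dl1 : forall t, a < t < b ->
    is_derive t 1 l1 (l2 t * (w ^+ 2 + 3 / x1 t ^+ 4));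
  arc_dl2 : forall t, a < t < b -> is_derive t 1 l2 (- l1 t);
  arc_H : forall t, a <= t <= b ->
    hamiltonian l0 (l1 t) (l2 t) (x1 t) (x2 t) (w ^+ 2) = 0
}.

(** Twice the mechanical energy under the constant control [w ^ 2]. *)
Definition energy (R : realType) (w x1 x2 : R) : R :=
  x2 ^+ 2 + w ^+ 2 * x1 ^+ 2 + (x1 ^+ 2)^-1.

Lemma arc_energy (R : realType) (w a b l0 : R) (x1 x2 l1 l2 : R -> R) :
  arc w a b l0 x1 x2 l1 l2 -> forall c s, a <= c <= b -> a <= s <= b ->
  energy w (x1 s) (x2 s) = energy w (x1 c) (x2 c).
Proof.
move=> A.
have cx1 : continuous x1 by exact: (arc_cx1 A).
have cx2 : continuous x2 by exact: (arc_cx2 A).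
have x0 t : x1 t != 0 by rewrite gt_eqF ?(arc_x1_gt0 A).
pose e t := x2 t * x2 t + w ^+ 2 * (x1 t * x1 t) + (x1 t * x1 t)^-1.
have ce : continuous e.
  apply: continuous_add; first by apply: continuous_add; [exact:
      continuous_mul|apply: continuous_mul; [exact: continuous_const|exact:
      continuous_mul]].
  by apply: continuous_inv; [move=> t; rewrite mulf_neq0|exact: continuous_mul].
have de (t : R) : a < t < b -> is_derive t 1 e 0.
  move=> tab; have d1 := arc_dx1 A tab; have d2 := arc_dx2 A tab.
  have xx : x1 t * x1 t != 0 by rewrite mulf_neq0.
  apply: is_derive_eq (is_derive1D (is_derive1D (is_derive1M d2 d2) (is_derive1Z _
      (is_derive1M d1 d1))) (is_derive1V (f := fun t => x1 t * x1 t) xx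
      (is_derive1M d1 d1))) _.
  by field.
by move=> c s cab sab; have := constant_itv ce de cab sab; rewrite /e /energy !expr2.
Qed.

Lemma arc_state (R : realType) (w a b l0 : R) (x1 x2 l1 l2 : R -> R) :
  0 < w -> arc w a b l0 x1 x2 l1 l2 ->
  forall c s, a <= c <= b -> a <= s <= b ->
  let C := cos (2 * w * (s - c)) in let S := sin (2 * w * (s - c)) in
  let K := energy w (x1 c) (x2 c) / (2 * w ^+ 2) in
  x1 s ^+ 2 = K + (x1 c ^+ 2 - K) * C + x1 c * x2 c / w * S /\
  x1 s * x2 s = - w * (x1 c ^+ 2 - K) * S + x1 c * x2 c * C.
Proof.
move=> w0 A c s cab sab C S K.
have wn0 : w != 0 by rewrite gt_eqF.
have cx1 : continuous x1 by exact: (arc_cx1 A).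
have cx2 : continuous x2 by exact: (arc_cx2 A).
have x0 t : x1 t != 0 by rewrite gt_eqF ?(arc_x1_gt0 A).
pose q t := x1 t * x1 t; pose p t := 2 * (x1 t * x2 t).
have cq : continuous q by exact: continuous_mul.
have cp : continuous p by apply: continuous_mul; [exact: continuous_const|exact:
    continuous_mul].
have dq (t : R) : a < t < b -> is_derive t 1 q (p t).
  by move=> tab; have d1 := arc_dx1 A tab; apply: is_derive_eq (is_derive1M d1 d1)
      _; rewrite /p; ring.
have dp (t : R) : a < t < b ->
    is_derive t 1 p (2 * energy w (x1 c) (x2 c) - 4 * w ^+ 2 * q t).
  move=> tab; have d1 := arc_dx1 A tab; have d2 := arc_dx2 A tab.
  apply: is_derive_eq (is_derive1Z 2 (is_derive1M d1 d2)) _.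
  have tab' : a <= t <= b by lra.
  by rewrite -(arc_energy A cab tab') /energy /q; field.
have [Hq Hp] := oscillator w0 cq cp dq dp cab sab.
rewrite -/C -/S -/K /q /p -!expr2 in Hq Hp.
split; first by rewrite Hq; field.
have -> : x1 s * x2 s = 2 * (x1 s * x2 s) / 2 by field.
by rewrite Hp; field.
Qed.

Lemma arc_costate (R : realType) (w a b l0 : R) (x1 x2 l1 l2 : R -> R) :
  0 < w -> arc w a b l0 x1 x2 l1 l2 ->
  forall c s, a <= c <= b -> a <= s <= b ->
  let C := cos (2 * w * (s - c)) in let S := sin (2 * w * (s - c)) in
  let K := l0 / (2 * w ^+ 2) in
  l2 s * x1 s = K + (l2 c * x1 c - K) * C + (l2 c * x2 c - l1 c * x1 c) / (2 * w) * S.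
Proof.
move=> w0 A c s cab sab C S K.
have wn0 : w != 0 by rewrite gt_eqF.
have cx1 : continuous x1 by exact: (arc_cx1 A).
have cx2 : continuous x2 by exact: (arc_cx2 A).
have cl1 : continuous l1 by exact: (arc_cl1 A).
have cl2 : continuous l2 by exact: (arc_cl2 A).
have x0 t : x1 t != 0 by rewrite gt_eqF ?(arc_x1_gt0 A).
pose f t := l2 t * x1 t; pose g t := l2 t * x2 t - l1 t * x1 t.
have cf : continuous f by exact: continuous_mul.
have cg : continuous g by apply: continuous_sub; exact: continuous_mul.
have df (t : R) : a < t < b -> is_derive t 1 f (g t).
  move=> tab; apply: is_derive_eq (is_derive1M (arc_dl2 A tab) (arc_dx1 A tab)) _.
  by rewrite /g; ring.
have dg (t : R) : a < t < b -> is_derive t 1 g (2 * l0 - 4 * w ^+ 2 * f t).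
  move=> tab.
  apply: is_derive_eq (is_derive1B (is_derive1M (arc_dl2 A tab) (arc_dx2 A tab))
      (is_derive1M (arc_dl1 A tab) (arc_dx1 A tab))) _.
  have tab' : a <= t <= b by lra.
  have := arc_H A tab'; rewrite /hamiltonian => H.
  (* [H = 0] trades the products [l1 x2] for [l0]; this closes the equation in [f]. *)
  have -> : l0 = - (l1 t * x2 t) - l2 t * ((x1 t ^+ 3)^-1 - x1 t * w ^+ 2) by move:
      H; lra.
  by rewrite /f; field.
by have [] := oscillator w0 cf cg df dg cab sab.
Qed.

(* At a rest point [c] the condition [H = 0] ties [l0] to [l2 c], and half a
   period away [l2] has the sign opposite to [l2 c]. *)
Lemma rest_arc (R : realType) (w a b l0 : R) (x1 x2 l1 l2 : R -> R) (sg c e : R) :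
  0 < w -> arc w a b l0 x1 x2 l1 l2 ->
  (forall t, a < t < b -> 0 < sg * l2 t) ->
  (c = a /\ e = b) \/ (c = b /\ e = a) -> x2 c = 0 ->
  [/\ 0 < 2 * w * (b - a) <= pi,
      (w ^+ 2 * x1 c ^+ 2 - (x1 c ^+ 2)^-1) * cos (2 * w * (b - a)) =
        2 * w ^+ 2 * x1 e ^+ 2 - energy w (x1 c) (x2 c)
    & energy w (x1 e) (x2 e) = energy w (x1 c) (x2 c)].
Proof.
move=> w0 A sgp ce x2c.
have wn0 : w != 0 by rewrite gt_eqF.
have ab := arc_lt A.
have xc0 := arc_x1_gt0 A c.
have xcn : x1 c != 0 by rewrite gt_eqF.
have cab : a <= c <= b by case: ce => [[-> _]|[-> _]]; lra.
have eab : a <= e <= b by case: ce => [[_ ->]|[_ ->]]; lra.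
have cl2 : continuous (fun t => sg * l2 t).
  by apply: continuous_mul; [exact: continuous_const|exact: (arc_cl2 A)].
split; last exact: (arc_energy A cab eab).
- apply/andP; split; first by rewrite !mulr_gt0// subr_gt0.
  rewrite leNgt; apply/negP => big.
  pose h := pi / (2 * w).
  have hb : h < b - a by rewrite /h ltr_pdivrMr ?mulr_gt0// mulrC.
  have h0 : 0 < h by rewrite /h divr_gt0 ?pi_gt0 ?mulr_gt0.
  (* The point half a period away from [c], taken towards the inside of the arc whichever end [c]
     is. *)
  have [s [sab Cs Ss]] : exists s, [/\ a < s < b,
      cos (2 * w * (s - c)) = -1 & sin (2 * w * (s - c)) = 0].
    have hE : 2 * w * h = pi by rewrite /h; field.
    case: ce => [[-> _]|[-> _]]; [exists (a + h)|exists (b - h)].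
      rewrite addrAC subrr add0r hE cospi sinpi; split=> //; lra.
    have -> : 2 * w * (b - h - b) = - pi by rewrite -hE; ring.
    by rewrite cosN sinN cospi sinpi oppr0; split=> //; lra.
  have sab' : a <= s <= b by lra.
  have := arc_costate w0 A cab sab'; rewrite /= Cs Ss mulr0 addr0.
  have := arc_H A cab; rewrite /hamiltonian x2c mulr0 addr0 => Hc Ms.
  have {Hc} E0 : l0 = l2 c * (x1 c * w ^+ 2 - (x1 c ^+ 3)^-1) by move: Hc; lra.
  have {}Ms : l2 s * x1 s * (w ^+ 2 * x1 c ^+ 4) = - (l2 c * x1 c).
    by rewrite Ms E0; field; rewrite xcn wn0.
  have sgc : 0 <= sg * l2 c by exact: (continuous_ge0_itv ab cl2 sgp).
  have sgs := sgp s sab.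
  have xs0 := arc_x1_gt0 A s.
  have : 0 < sg * l2 s * (x1 s * (w ^+ 2 * x1 c ^+ 4)).
    by rewrite mulr_gt0// !mulr_gt0// exprn_gt0.
  have -> : sg * l2 s * (x1 s * (w ^+ 2 * x1 c ^+ 4)) =
      sg * (l2 s * x1 s * (w ^+ 2 * x1 c ^+ 4)) by ring.
  by rewrite Ms mulrN mulrA oppr_gt0 ltNge mulr_ge0// ltW.
- have [Q _] := arc_state w0 A cab eab.
  rewrite x2c mulr0 mul0r mul0r addr0 in Q.
  have -> : cos (2 * w * (b - a)) = cos (2 * w * (e - c)).
    case: ce => [[-> ->]//|[-> ->]].
    by rewrite -[in RHS]cosN; congr cos; ring.
  by rewrite Q /energy x2c; field; rewrite xcn wn0.
Qed.

Lemma switching_angle (R : realType) (w r phi : R) :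
  0 < w -> w * cos phi + r * sin phi = 0 ->
  cos phi = - (r * sin phi) / w /\ sin phi ^+ 2 = w ^+ 2 / (r ^+ 2 + w ^+ 2).
Proof.
move=> w0 g0; have wn0 : w != 0 by rewrite gt_eqF.
have cE : cos phi = - (r * sin phi) / w.
  have E : w * cos phi = - (r * sin phi) by lra.
  by apply: (mulfI wn0); rewrite E; field.
split=> //.
have s0 : 0 < r ^+ 2 + w ^+ 2 by rewrite ltr_wpDl ?sqr_ge0// exprn_gt0.
have H : sin phi ^+ 2 * (r ^+ 2 + w ^+ 2) = w ^+ 2.
  have H := cos2Dsin2 phi; rewrite cE in H.
  by rewrite -[RHS]mulr1 -H; field.
by rewrite -[X in X / _]H mulfK// gt_eqF.
Qed.

(** From a zero of [l2] on, [H = 0] makes [l2 x1] a multiple of [sin t * (w * cos t + r * sin t)],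
    with [t] the elapsed time multiplied by [w]. The second factor goes from [w] at [0] to [- w] at
    [pi], so it vanishes before the sine does and determines the end of the arc. *)
Lemma switching_arc (R : realType) (w a b l0 : R) (x1 x2 l1 l2 : R -> R) (sg : R) :
  0 < w -> arc w a b l0 x1 x2 l1 l2 ->
  (forall t, a < t < b -> 0 < sg * l2 t) ->
  l2 a = 0 -> l2 b = 0 -> l1 a <> 0 ->
  let r := x2 a / x1 a in let phi := w * (b - a) in
  [/\ 0 < phi < pi, w * cos phi + r * sin phi = 0,
      x1 b ^+ 2 = ((r ^+ 2 + w ^+ 2) * x1 a ^+ 2)^-1
    & x2 b / x1 b = - r].
Proof.
move=> w0 A sgp l2a l2b l1a r phi.
have wn0 : w != 0 by rewrite gt_eqF.
have ab := arc_lt A.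
have xa0 := arc_x1_gt0 A a; have xb0 := arc_x1_gt0 A b.
have xan : x1 a != 0 by rewrite gt_eqF.
have xbn : x1 b != 0 by rewrite gt_eqF.
have aab : a <= a <= b by lra.
have bab : a <= b <= b by lra.
have M s : a <= s <= b -> l2 s * x1 s = - (l1 a * x1 a / w ^+ 2) *
    sin (w * (s - a)) * (w * cos (w * (s - a)) + r * sin (w * (s - a))).
  move=> sab; rewrite (arc_costate w0 A aab sab) /=.
  have := arc_H A aab; rewrite /hamiltonian l2a !mul0r addr0 => Hc.
  have -> : l0 = - (l1 a * x2 a) by lra.
  have -> : 2 * w * (s - a) = (w * (s - a)) *+ 2 by rewrite -mulr_natl; ring.
  rewrite cos_mulr2n sin_mulr2n !mulr2n cos2sin2 /r.
  by field; rewrite xan wn0.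
pose g t := w * cos t + r * sin t.
have cg : continuous g.
  apply: continuous_add; apply: continuous_mul; try exact: continuous_const;
      [exact: continuous_cos|exact: continuous_sin].
have phi0 : 0 < phi by rewrite mulr_gt0// subr_gt0.
have phipi : phi < pi.
  rewrite ltNge; apply/negP => big.
  have H0 : Num.min (g 0) (g pi) <= 0 <= Num.max (g 0) (g pi).
    by rewrite /g cos0 sin0 cospi sinpi ge_min le_max; lra.
  have [t] := IVT (pi_ge0 R) (continuous_subspaceT cg) H0.
  rewrite in_itv /= => t0pi gt0.
  have t0 : t != 0.
    by apply/eqP => t0; move: gt0; rewrite /g t0 cos0 sin0; lra.
  have tpi : t != pi.
    by apply/eqP => t0'; move: gt0; rewrite /g t0' cospi sinpi; lra.
  have {}t0pi : 0 < t < pi by rewrite !lt_neqAle eq_sym t0 tpi /=; lra.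
  pose s := a + t / w.
  have tE : w * (s - a) = t by rewrite /s; field.
  have sab : a < s < b.
    have tw : 0 < t / w by rewrite divr_gt0//; lra.
    have : t / w < b - a by rewrite ltr_pdivrMr// mulrC; apply: lt_le_trans big; lra.
    by rewrite /s; lra.
  have := M s; rewrite tE -/(g t) gt0 mulr0 => Ms.
  have := sgp s sab.
  have xs0 := arc_x1_gt0 A s.
  have /eqP : l2 s * x1 s = 0 by apply: Ms; lra.
  by rewrite mulf_eq0 (gt_eqF xs0) orbF => /eqP ->; rewrite mulr0 ltxx.
have sphi : 0 < sin phi by apply: sin_gt0_pi; rewrite phi0.
have g0 : w * cos phi + r * sin phi = 0.
  have /eqP := M b bab; rewrite l2b mul0r eq_sym -/phi !mulf_eq0 (gt_eqF sphi) !orbF.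
  rewrite oppr_eq0 !mulf_eq0 (negbTE xan) invr_eq0 expf_eq0 (negbTE wn0) /= !orbF.
  by case/orP => /eqP.
have [cE s2E] := switching_angle w0 g0.
have s0 : 0 < r ^+ 2 + w ^+ 2 by rewrite ltr_wpDl ?sqr_ge0// exprn_gt0.
have [Q P] := arc_state w0 A aab bab.
rewrite -/phi in Q P.
have th2 : 2 * w * (b - a) = phi *+ 2 by rewrite /phi -mulr_natl; ring.
rewrite th2 cos_mulr2n sin_mulr2n !mulr2n cos2sin2 s2E in Q P.
have x2E : x2 a = r * x1 a by rewrite /r divfK.
have csE : cos phi * sin phi = - r * w / (r ^+ 2 + w ^+ 2).
  rewrite cE.
  have -> : - (r * sin phi) / w * sin phi = - r * (sin phi ^+ 2) / w by field.
  by rewrite s2E; field; rewrite wn0 gt_eqF.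
have qb : x1 b ^+ 2 = ((r ^+ 2 + w ^+ 2) * x1 a ^+ 2)^-1.
  rewrite Q csE /energy x2E; field.
  by rewrite xan wn0 gt_eqF.
split=> //; first by rewrite phi0.
have : x1 b * x2 b = - r * x1 b ^+ 2.
  rewrite P csE qb /energy x2E; field.
  by rewrite xan wn0 gt_eqF.
move=> E; have -> : x2 b / x1 b = x1 b * x2 b / x1 b ^+ 2 by field.
by rewrite E; field.
Qed.

(** [cos (2 phi)] sees only [r ^ 2]; as [cos phi = - r sin phi / w], the sign of [r] tells whether
    [phi] is at most [pi / 2], that is, which branch of the inverse cosine applies. *)
Lemma switching_arc_time (R : realType) (w r phi : R) :
  0 < w -> 0 < phi < pi -> w * cos phi + r * sin phi = 0 ->
  2 * phi = if r <= 0 then acos ((r ^+ 2 - w ^+ 2) / (r ^+ 2 + w ^+ 2))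
            else 2 * pi - acos ((r ^+ 2 - w ^+ 2) / (r ^+ 2 + w ^+ 2)).
Proof.
move=> w0 phi_in g0.
have wn0 : w != 0 by rewrite gt_eqF.
have sphi : 0 < sin phi by apply: sin_gt0_pi.
have [cE s2E] := switching_angle w0 g0.
have s0 : 0 < r ^+ 2 + w ^+ 2 by rewrite ltr_wpDl ?sqr_ge0// exprn_gt0.
have c2 : cos (2 * phi) = (r ^+ 2 - w ^+ 2) / (r ^+ 2 + w ^+ 2).
  rewrite mulr_natl cos_mulr2n mulr2n cos2sin2 s2E; field.
  by rewrite gt_eqF.
rewrite -c2; case: ifP => r0.
  rewrite cosK// in_itv /=; apply/andP; split; first lra.
  rewrite -ler_pdivlMl// mulrC leNgt; apply/negP => H.
  have : cos phi < cos (pi / 2).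
    by rewrite ltr_cos// in_itv /= ?phi_in; have := pi_gt0 R; lra.
  rewrite cos_pihalf cE ltNge divr_ge0 ?(ltW w0)//.
  by rewrite oppr_ge0 mulr_le0_ge0// ltW.
have -> : cos (2 * phi) = cos (2 * pi - 2 * phi).
  by rewrite -[in LHS]cosN -[in LHS](cosD2pi) mulr_natl; congr cos; ring.
rewrite cosK; first by ring.
rewrite in_itv /=; apply/andP; split; first lra.
rewrite lerBlDr -lerBlDl; have -> : 2 * pi - pi = pi :> R by ring.
rewrite -ler_pdivrMl// mulrC leNgt; apply/negP => H.
have : cos (pi / 2) < cos phi.
  by rewrite ltr_cos// in_itv /= ?phi_in; have := pi_gt0 R; lra.
rewrite cos_pihalf cE; apply/negP; rewrite -leNgt mulr_le0_ge0 ?invr_ge0 ?(ltW w0)//.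
by rewrite oppr_le0 mulr_ge0 ?(ltW sphi)//; move/negbT: r0; rewrite -ltNge => /ltW.
Qed.

(** * Chains of arcs *)

Lemma chain_arc (R : realType) (gamma u1 u2 T : R) (u : R -> R) (l0 : R)
    (x1 x2 l1 l2 : R -> R) b m tau i :
  0 < u1 -> 0 < u2 ->
  regular_extremal gamma u1 u2 T u l0 x1 x2 l1 l2 -> chain l2 T b m tau ->
  (i < m)%N ->
  arc (Num.sqrt (ctl u1 u2 (b (+) odd i))) (tau i) (tau i.+1) l0 x1 x2 l1 l2.
Proof.
move=> u10 u20 E C im.
have ui := chain_control E C im.
have /andP[r0 _] := chain_range C (ltnW im); have /andP[_ rT] := chain_range C im.
have lt := ch_lt C im.
have v0 : 0 <= ctl u1 u2 (b (+) odd i) by rewrite /ctl; case: (_ (+) _); exact: ltW.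
split; rewrite ?sqr_sqrtr//.
- exact: (re_cx1 E).
- exact: (re_cx2 E).
- exact: (re_cl1 E).
- exact: (re_cl2 E).
- exact: (re_x1_gt0 E).
- by move=> t ti; apply: (re_dx1 E); lra.
- exact: (re_dx2 E r0 lt rT ui).
- exact: (re_dl1 E r0 lt rT ui).
- by move=> t ti; apply: (re_dl2 E); lra.
- exact: (re_H E r0 lt rT ui).
Qed.

Definition slope (R : realType) (x1 x2 : R -> R) (t : R) : R := x2 t / x1 t.

Lemma energy_slope (R : realType) (w : R) (x1 x2 : R -> R) (t : R) : 0 < x1 t ->
  energy w (x1 t) (x2 t) =
  (slope x1 x2 t ^+ 2 + w ^+ 2) * x1 t ^+ 2 + (x1 t ^+ 2)^-1.
Proof. by move=> x0; rewrite /energy /slope; field; rewrite gt_eqF. Qed.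

Lemma chain_first (R : realType) (gamma u1 u2 T : R) (u : R -> R) (l0 : R)
    (x1 x2 l1 l2 : R -> R) b m tau (v := ctl u1 u2 b) :
  0 < u1 -> 0 < u2 ->
  regular_extremal gamma u1 u2 T u l0 x1 x2 l1 l2 -> chain l2 T b m tau ->
  (0 < m)%N ->
  [/\ 0 < 2 * Num.sqrt v * tau 1%N <= pi,
      (v - 1) * cos (2 * Num.sqrt v * tau 1%N) =
        2 * v * x1 (tau 1%N) ^+ 2 - (v + 1)
    & (slope x1 x2 (tau 1%N) ^+ 2 + v) * x1 (tau 1%N) ^+ 2
        + (x1 (tau 1%N) ^+ 2)^-1 = v + 1].
Proof.
move=> u10 u20 E C m0.
have A := chain_arc u10 u20 E C m0; rewrite /= addbF -/v in A.
have v0 : 0 < v by rewrite /v /ctl; case: (b).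
have w0 : 0 < Num.sqrt v by rewrite sqrtr_gt0.
have [x10 x20] := re_start E; have t0 := ch_0 C.
have sg : forall t, tau 0%N < t < tau 1%N -> 0 < sgnb R b * l2 t.
  by move=> t tt; have := ch_sgn C m0 tt; rewrite /= addbF.
have x2t0 : x2 (tau 0%N) = 0 by rewrite t0.
have [H1 H2 H3] := rest_arc w0 A sg (or_introl (conj erefl erefl)) x2t0.
rewrite t0 subr0 /energy x10 x20 sqr_sqrtr ?(ltW v0)// in H1 H2.
rewrite (energy_slope _ _ (re_x1_gt0 E _)) /energy t0 x10 x20 sqr_sqrtr ?(ltW v0)//
    in H3.
split=> //; first by move: H2; rewrite !expr1n invr1 expr0n /= mulr1 add0r.
by rewrite H3 !expr1n invr1 expr0n /= mulr1 add0r.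
Qed.

Lemma chain_last (R : realType) (gamma u1 u2 T : R) (u : R -> R) (l0 : R)
    (x1 x2 l1 l2 : R -> R) b m tau (v := ctl u1 u2 (b (+) odd m)) :
  0 < u1 -> 0 < u2 ->
  regular_extremal gamma u1 u2 T u l0 x1 x2 l1 l2 -> chain l2 T b m.+1 tau ->
  [/\ 0 < 2 * Num.sqrt v * (T - tau m) <= pi,
      (v * gamma ^+ 2 - (gamma ^+ 2)^-1) * cos (2 * Num.sqrt v * (T - tau m)) =
        2 * v * x1 (tau m) ^+ 2 - c_fin gamma v
    & (slope x1 x2 (tau m) ^+ 2 + v) * x1 (tau m) ^+ 2
        + (x1 (tau m) ^+ 2)^-1 = c_fin gamma v].
Proof.
move=> u10 u20 E C.
have A := chain_arc u10 u20 E C (ltnSn m); rewrite -/v in A.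
have v0 : 0 < v by rewrite /v /ctl; case: (_ (+) _).
have w0 : 0 < Num.sqrt v by rewrite sqrtr_gt0.
have [x1T x2T] := re_end E; have tT := ch_m C.
have sg := ch_sgn C (ltnSn m).
have x2t : x2 (tau m.+1) = 0 by rewrite tT.
have [H1 H2 H3] := rest_arc w0 A sg (or_intror (conj erefl erefl)) x2t.
rewrite tT /energy x1T x2T sqr_sqrtr ?(ltW v0)// in H1 H2.
rewrite (energy_slope _ _ (re_x1_gt0 E _)) /energy tT x1T x2T sqr_sqrtr ?(ltW v0)//
    in H3.
rewrite /c_fin; split=> //; first by rewrite H2 expr0n /= add0r.
by rewrite H3 expr0n /= add0r.
Qed.

Lemma chain_mid (R : realType) (gamma u1 u2 T : R) (u : R -> R) (l0 : R)
    (x1 x2 l1 l2 : R -> R) b m tau i (v := ctl u1 u2 (b (+) odd i))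
    (r := slope x1 x2 (tau i)) :
  0 < u1 -> 0 < u2 ->
  regular_extremal gamma u1 u2 T u l0 x1 x2 l1 l2 -> chain l2 T b m tau ->
  (0 < i)%N -> (i.+1 < m)%N ->
  [/\ x1 (tau i.+1) ^+ 2 = ((r ^+ 2 + v) * x1 (tau i) ^+ 2)^-1,
      slope x1 x2 (tau i.+1) = - r
    & 2 * Num.sqrt v * (tau i.+1 - tau i) =
        if r <= 0 then acos ((r ^+ 2 - v) / (r ^+ 2 + v))
        else 2 * pi - acos ((r ^+ 2 - v) / (r ^+ 2 + v))].
Proof.
move=> u10 u20 E C i0 im.
have im' := ltnW im.
have A := chain_arc u10 u20 E C im'; rewrite -/v in A.
have v0 : 0 < v by rewrite /v /ctl; case: (_ (+) _).
have w0 : 0 < Num.sqrt v by rewrite sqrtr_gt0.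
have z1 : l2 (tau i) = 0 by apply: (ch_z C); rewrite i0.
have z2 : l2 (tau i.+1) = 0 by apply: (ch_z C).
have nz : l1 (tau i) <> 0.
  by move=> z3; apply: (re_nz E (chain_range C (ltnW im'))); rewrite z1 z3.
have [H1 H2 H3 H4] := switching_arc w0 A (ch_sgn C im') z1 z2 nz.
have := switching_arc_time w0 H1 H2.
rewrite sqr_sqrtr ?(ltW v0)// in H3 *.
by rewrite /r /slope mulrA; split.
Qed.

(** At a switching [l1 x2 = - l0 >= 0], and [l1] has there the sign that [l2] had just before. So
    [r <= 0] when an [X]-arc begins and [r >= 0] when a [Y]-arc begins, which selects the branch in
    [chain_mid]. *)
Lemma chain_slope_sign (R : realType) (gamma u1 u2 T : R) (u : R -> R) (l0 : R)
    (x1 x2 l1 l2 : R -> R) b m tau i :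
  0 < u1 -> 0 < u2 ->
  regular_extremal gamma u1 u2 T u l0 x1 x2 l1 l2 -> chain l2 T b m tau ->
  (0 < i < m)%N -> 0 <= - sgnb R (b (+) odd i) * slope x1 x2 (tau i).
Proof.
move=> u10 u20 E C; case: i => // i /andP[_ im].
have A := chain_arc u10 u20 E C (ltnW im).
have z : l2 (tau i.+1) = 0 by apply: (ch_z C).
have lt := ch_lt C (ltnW im).
have r1 := chain_range C (ltnW im).
have r0 : 0 <= tau i by have /andP[] := chain_range C (ltnW (ltnW im)).
have [e e0 He] := switching_sign E r1 z.
set t := tau i.+1 in He r1 z lt *.
pose d := Num.min (e / 2) ((t - tau i) / 2).
have d0 : 0 < d by rewrite /d !lt_min; lra.
have de : d <= e / 2 by rewrite /d ge_min lexx.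
have d1 : d <= (t - tau i) / 2 by rewrite /d !ge_min lexx ?orbT.
have N1 : l2 (t - d) * (t - d - t) * l1 t < 0.
  by apply: He; [lra|apply/eqP; lra|rewrite ltr_distl; lra].
have {}N1 : 0 < l2 (t - d) * l1 t.
  have : 0 < d * (l2 (t - d) * l1 t) by lra.
  by rewrite pmulr_rgt0.
have P1 : 0 < sgnb R (b (+) odd i) * l2 (t - d) by apply: (ch_sgn C (ltnW im));
    rewrite -/t; lra.
have xt := re_x1_gt0 E t.
have H : l1 t * x2 t = - l0.
  have tt : tau i <= t <= tau i.+1 by rewrite -/t; lra.
  by have := arc_H A tt; rewrite /hamiltonian z mul0r; lra.
have l00 := re_l0 E.
rewrite /= addbN /slope mulrA pmulr_lge0 ?invr_gt0//.
by move: P1; case: (_ (+) _); rewrite /sgnb /= => P1; nra.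
Qed.

Lemma chain_sqr (R : realType) (gamma u1 u2 T : R) (u : R -> R) (l0 : R)
    (x1 x2 l1 l2 : R -> R) b m tau i :
  0 < u1 -> 0 < u2 ->
  regular_extremal gamma u1 u2 T u l0 x1 x2 l1 l2 -> chain l2 T b m tau ->
  (0 < i < m)%N -> slope x1 x2 (tau i) ^+ 2 = slope x1 x2 (tau 1%N) ^+ 2.
Proof.
move=> u10 u20 E C; elim: i => [//|[//|i] IHi] /andP[_ im].
have [_ -> _] := chain_mid u10 u20 E C (ltn0Sn i) im.
by rewrite sqrrN IHi// (ltnW im).
Qed.

Lemma chain_X_arc (R : realType) (gamma u1 u2 T : R) (u : R -> R) (l0 : R)
    (x1 x2 l1 l2 : R -> R) b m tau i (s := slope x1 x2 (tau 1%N) ^+ 2) :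
  0 < u1 -> 0 < u2 ->
  regular_extremal gamma u1 u2 T u l0 x1 x2 l1 l2 -> chain l2 T b m tau ->
  (0 < i)%N -> (i.+1 < m)%N -> b (+) odd i = false ->
  x1 (tau i.+1) ^+ 2 = ((s + u1) * x1 (tau i) ^+ 2)^-1 /\
  tau i.+1 - tau i = time_X u1 s.
Proof.
move=> u10 u20 E C i0 im bi.
have i0m : (0 < i < m)%N by rewrite i0 ltnW.
have [H1 _ H2] := chain_mid u10 u20 E C i0 im.
have := chain_slope_sign u10 u20 E C i0m; rewrite bi /sgnb mulN1r oppr_ge0 => r0.
rewrite bi /= r0 (chain_sqr u10 u20 E C i0m) -/s in H1 H2.
split=> //; rewrite /time_X -H2 mulKf// mulf_neq0 ?pnatr_eq0//.
by rewrite gt_eqF// sqrtr_gt0.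
Qed.

Lemma chain_Y_arc (R : realType) (gamma u1 u2 T : R) (u : R -> R) (l0 : R)
    (x1 x2 l1 l2 : R -> R) b m tau i (s := slope x1 x2 (tau 1%N) ^+ 2) :
  0 < u1 -> 0 < u2 ->
  regular_extremal gamma u1 u2 T u l0 x1 x2 l1 l2 -> chain l2 T b m tau ->
  (0 < i)%N -> (i.+1 < m)%N -> b (+) odd i = true ->
  x1 (tau i.+1) ^+ 2 = ((s + u2) * x1 (tau i) ^+ 2)^-1 /\
  tau i.+1 - tau i = time_Y u2 s.
Proof.
move=> u10 u20 E C i0 im bi.
have i0m : (0 < i < m)%N by rewrite i0 ltnW.
have [H1 _ H2] := chain_mid u10 u20 E C i0 im.
have := chain_slope_sign u10 u20 E C i0m; rewrite bi /sgnb opprK mul1r => r0.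
have sE := chain_sqr u10 u20 E C i0m; rewrite -/s in sE.
rewrite bi /= sE in H1 H2.
split=> //; rewrite /time_Y.
have <- : 2 * Num.sqrt u2 * (tau i.+1 - tau i) =
    2 * pi - acos ((s - u2) / (s + u2)).
  rewrite H2; case: ifP => // r0'.
  (* In the limiting case [r = 0] the two branches agree: both equal [pi]. *)
  have r00 : slope x1 x2 (tau i) = 0 by apply/eqP; rewrite eq_le r0 r0'.
  rewrite -sE r00 expr0n /= sub0r add0r mulNr divff ?gt_eqF// acosN1.
  by ring.
by rewrite mulKf// mulf_neq0 ?pnatr_eq0// gt_eqF// sqrtr_gt0.
Qed.

(** Each inner arc inverts [x1 ^ 2] up to a factor, so a pair of arcs rescales it. This is the
    source of the powers in the transcendental equations. *)
Lemma chain_YX_iter (R : realType) (gamma u1 u2 T : R) (u : R -> R) (l0 : R)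
    (x1 x2 l1 l2 : R -> R) b m tau i k (s := slope x1 x2 (tau 1%N) ^+ 2) :
  0 < u1 -> 0 < u2 ->
  regular_extremal gamma u1 u2 T u l0 x1 x2 l1 l2 -> chain l2 T b m tau ->
  (0 < i)%N -> (i + k.*2 < m)%N -> b (+) odd i = true ->
  x1 (tau (i + k.*2)%N) ^+ 2 = x1 (tau i) ^+ 2 * ((s + u2) / (s + u1)) ^+ k /\
  tau (i + k.*2)%N = tau i + k%:R * (time_X u1 s + time_Y u2 s).
Proof.
move=> u10 u20 E C i0 + bi; elim: k => [|k IHk].
  by rewrite addn0 expr0 mulr1 mul0r addr0.
rewrite doubleS !addnS => im.
have [Q1 t1] := IHk (ltnW (ltnW im)).
have j0 : (0 < i + k.*2)%N by rewrite addn_gt0 i0.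
have bj : b (+) odd (i + k.*2) = true by rewrite oddD odd_double addbF.
have [Q2 t2] := chain_Y_arc u10 u20 E C j0 (ltnW im) bj.
have bj' : b (+) odd (i + k.*2).+1 = false by rewrite /= addbN bj.
have [Q3 t3] := chain_X_arc u10 u20 E C (ltn0Sn _) im bj'.
have s0 : 0 <= s by exact: sqr_ge0.
have xi := re_x1_gt0 E (tau i).
have su1 : s + u1 != 0 by rewrite gt_eqF// ltr_wpDl.
have su2 : s + u2 != 0 by rewrite gt_eqF// ltr_wpDl.
rewrite Q3 Q2 Q1 -/s [_ ^+ k.+1]exprS; split.
  have : ((s + u2) / (s + u1)) ^+ k != 0 by rewrite expf_neq0// mulf_neq0 ?invr_eq0.
  move: (_ ^+ k) => Y Y0.
  have : x1 (tau i) ^+ 2 != 0 by rewrite expf_neq0// gt_eqF.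
  by move: (_ ^+ 2) => X X0; field; rewrite X0 Y0 su1 su2.
rewrite -natr1; move: t1 t2 t3; rewrite -/s; lra.
Qed.

(** * Transfer times and transcendental equations *)

(** [X] is [x1 ^ 2] at the end at rest and [q] its value at the switching. By the energy relation
    [q] is a root of [(s + v) q ^ 2 - K q + 1], and [z] is the square root of the discriminant,
    signed according to the root. Since [Num.sqrt (K ^ 2 - 4 v)] is [|d|], solving for [cos th]
    splits on the sign of [d]. The relation [d ^ 2 = z ^ 2 + 4 s] is the source of the upper bounds
    on [s]. *)
Lemma rest_time (R : realType) (v X s q th : R) :
  0 < v -> 0 < s -> 0 < q -> X != 0 -> 0 <= th <= pi ->
  let d := v * X - X^-1 in let K := v * X + X^-1 in let z := 2 * (s + v) * q - K in
  d * cos th = 2 * v * q - K -> (s + v) * q + q^-1 = K ->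
  [/\ K ^+ 2 - 4 * (s + v) = z ^+ 2, d ^+ 2 = z ^+ 2 + 4 * s,
      0 < d -> th = acos ((- s * K + v * z) / ((s + v) * Num.sqrt (K ^+ 2 - 4 * v)))
    & d < 0 -> th = acos ((s * K - v * z) / ((s + v) * Num.sqrt (K ^+ 2 - 4 * v)))].
Proof.
move=> v0 s0 q0 X0 thpi d K z Hc He.
have qn : q != 0 by rewrite gt_eqF.
have svn : s + v != 0 by rewrite gt_eqF// addr_gt0.
have dK : K ^+ 2 - 4 * v = d ^+ 2 by rewrite /K /d; field.
have zE : K ^+ 2 - 4 * (s + v) = z ^+ 2 by rewrite /z -He; field.
have cK (e : R) : e = cos th -> th = acos e by move=> ->; rewrite cosK// in_itv.
split=> //; first by move: zE dK; lra.
  move=> d0; apply: cK; rewrite dK sqrtr_sqr gtr0_norm//.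
  have -> : cos th = d * cos th / d by rewrite mulrC mulKf// gt_eqF.
  by rewrite Hc /z; field; rewrite svn gt_eqF.
move=> d0; apply: cK; rewrite dK sqrtr_sqr ltr0_norm//.
have -> : cos th = d * cos th / d by rewrite mulrC mulKf// lt_eqF.
by rewrite Hc /z; field; rewrite svn lt_eqF.
Qed.

Lemma sign_sqrt_sqr (R : realType) (z : R) :
  exists2 sg : R, sg = 1 \/ sg = -1 & sg * Num.sqrt (z ^+ 2) = z.
Proof.
rewrite sqrtr_sqr; have [z0|z0] := lerP 0 z.
  by exists 1; [left|rewrite mul1r ger0_norm].
by exists (-1); [right|rewrite mulN1r ltr0_norm ?opprK].
Qed.

Lemma time_of_angle (R : realType) (v t th : R) : 0 < v ->
  2 * Num.sqrt v * t = th -> t = (2 * Num.sqrt v)^-1 * th.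
Proof.
by move=> v0 <-; rewrite mulKf// mulf_neq0 ?pnatr_eq0// gt_eqF// sqrtr_gt0.
Qed.

Lemma first_X_gt1 (R : realType) (v q th : R) : 0 < v < 1 -> 0 < th <= pi ->
  (v - 1) * cos th = 2 * v * q - (v + 1) -> 1 < q.
Proof.
move=> v01 thpi E.
have c1 : cos th < 1.
  by rewrite -cos0 ltr_cos ?in_itv /= ?lexx ?pi_ge0//; lra.
have H : 0 < (1 - v) * (1 - cos th) by rewrite mulr_gt0//; lra.
have : 0 < v * (q - 1) by move: H E; lra.
by rewrite pmulr_rgt0 ?subr_gt0//; lra.
Qed.

Lemma first_Y_le1 (R : realType) (v q th : R) : 1 <= v ->
  (v - 1) * cos th = 2 * v * q - (v + 1) -> q <= 1.
Proof.
move=> v1 E.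
have H : 0 <= (v - 1) * (1 - cos th) by rewrite mulr_ge0// subr_ge0// cos_le1.
have : 0 <= v * (1 - q) by move: H E; lra.
by rewrite pmulr_rge0 ?subr_ge0//; lra.
Qed.

Lemma chain_first_q (R : realType) (gamma u1 u2 T : R) (u : R -> R) (l0 : R)
    (x1 x2 l1 l2 : R -> R) b m tau :
  0 < u1 -> u1 < 1 -> 1 <= u2 ->
  regular_extremal gamma u1 u2 T u l0 x1 x2 l1 l2 -> chain l2 T b m tau ->
  (0 < m)%N ->
  if b then x1 (tau 1%N) ^+ 2 <= 1 else 1 < x1 (tau 1%N) ^+ 2.
Proof.
move=> u10 u11 u21 E C m0.
have u20 : 0 < u2 by lra.
have [H1 H2 _] := chain_first u10 u20 E C m0.
case: (b) H1 H2 => /= H1 H2; first exact: first_Y_le1 H2.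
by apply: first_X_gt1 H1 H2; rewrite u10.
Qed.

(** Counted from the start of an inner [X]-arc, the pair [X], [Y] multiplies [x1 ^ 2] by
    [(s + u1) / (s + u2) <= 1]. This reduces the claim to the first switching from [Y] to [X], which
    has index 1 or 2 according to the type of the first arc. *)
Lemma chain_YX_le1 (R : realType) (gamma u1 u2 T : R) (u : R -> R) (l0 : R)
    (x1 x2 l1 l2 : R -> R) b m tau i :
  0 < u1 -> u1 < 1 -> 1 <= u2 ->
  regular_extremal gamma u1 u2 T u l0 x1 x2 l1 l2 -> chain l2 T b m tau ->
  (0 < i < m)%N -> b (+) odd i = false -> x1 (tau i) ^+ 2 <= 1.
Proof.
move=> u10 u11 u21 E C.
have u20 : 0 < u2 by lra.
set s := slope x1 x2 (tau 1%N) ^+ 2.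
have s0 : 0 <= s by exact: sqr_ge0.
have q0 j : 0 < x1 (tau j) ^+ 2 by rewrite exprn_gt0// (re_x1_gt0 E).
elim/ltn_ind: i => -[//|[|[|i]]] IH /andP[_ im] bi.
- have := chain_first_q u10 u11 u21 E C (ltnW im).
  by move: bi; rewrite addbT; case: (b).
- have m0 : (0 < m)%N by apply: leq_trans im.
  have bF : b = false by move: bi; rewrite addbF.
  have b1 : b (+) odd 1 = true by rewrite bF.
  have [-> _] := chain_Y_arc u10 u20 E C (ltn0Sn 0) im b1.
  have := chain_first_q u10 u11 u21 E C m0; rewrite bF -/s => q1.
  rewrite invf_le1; last by rewrite mulr_gt0// ltr_wpDl.
  by apply: mulr_ege1; [lra|exact: ltW].
- have bi' : b (+) odd i.+1 = false by move: bi; rewrite /= negbK.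
  have bi2 : b (+) odd i.+2 = true by move: bi'; rewrite /= !addbN => ->.
  have Hi : x1 (tau i.+1) ^+ 2 <= 1.
    by apply: IH => //; exact: (ltnW (ltnW im)).
  have [Q1 _] := chain_X_arc u10 u20 E C (ltn0Sn i) (ltnW im) bi'.
  have [-> _] := chain_Y_arc u10 u20 E C (ltn0Sn i.+1) im bi2.
  rewrite Q1 -/s; apply: le_trans Hi.
  have -> : ((s + u2) * ((s + u1) * x1 (tau i.+1) ^+ 2)^-1)^-1 =
      (s + u1) / (s + u2) * x1 (tau i.+1) ^+ 2.
    have n1 : s + u1 != 0 by rewrite gt_eqF// ltr_wpDl.
    have n2 : s + u2 != 0 by rewrite gt_eqF// ltr_wpDl.
    have n3 : x1 (tau i.+1) != 0 by rewrite gt_eqF// (re_x1_gt0 E).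
    by field; rewrite ?n1 ?n2 ?n3.
  by rewrite ger_pMl// ler_pdivrMr ?ltr_wpDl//; lra.
Qed.

(** The second bound says that under [u1] a point at rest at [x1 = gamma] is not pulled inwards. *)
Lemma gamma_u1 (R : realType) (gamma u1 : R) :
  1 < gamma -> 0 < u1 -> u1 <= 1 / gamma ^+ 4 ->
  u1 < 1 /\ u1 * gamma ^+ 2 <= (gamma ^+ 2)^-1.
Proof.
move=> g1 u10 u1g.
have g0 : 0 < gamma by lra.
have g2 : 1 < gamma ^+ 2 by rewrite expr2; nra.
have g4 : 1 < gamma ^+ 4 by rewrite exprn_egt1.
split; first by apply: le_lt_trans u1g _; rewrite div1r invf_lt1//; lra.
rewrite -ler_pdivlMr; last lra.
by rewrite -invfM -exprD -div1r.
Qed.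

(* On a final [X]-arc the target would be the leftmost point, whereas such an
   arc starts at some [x1 <= 1]. *)
Lemma chain_last_Y (R : realType) (gamma u1 u2 T : R) (u : R -> R) (l0 : R)
    (x1 x2 l1 l2 : R -> R) b m tau :
  1 < gamma -> 0 < u1 -> u1 <= 1 / gamma ^+ 4 -> 1 <= u2 ->
  regular_extremal gamma u1 u2 T u l0 x1 x2 l1 l2 -> chain l2 T b m.+1 tau ->
  b (+) odd m = true /\ (0 < m)%N.
Proof.
move=> g1 u10 u1g u21 E C.
have [u11 ug] := gamma_u1 g1 u10 u1g.
have u20 : 0 < u2 by lra.
have g2 : 1 < gamma ^+ 2 by rewrite expr2; nra.
have lastY : b (+) odd m = true.
  case bm : (b (+) odd m) => //; exfalso.
  have [_] := chain_last u10 u20 E C; rewrite bm /c_fin /= => H _.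
  have q1 : x1 (tau m) ^+ 2 <= 1.
    case: (m) C bm H => [|n] C bm _.
      by rewrite (ch_0 C) (re_start E).1 expr1n.
    by apply: (chain_YX_le1 u10 u11 u21 E C _ bm); rewrite /= ltnSn.
  have : 0 <= ((gamma ^+ 2)^-1 - u1 * gamma ^+ 2) *
      (1 - cos (2 * Num.sqrt u1 * (T - tau m))).
    by rewrite mulr_ge0 ?subr_ge0// cos_le1.
  have : 0 < u1 * (gamma ^+ 2 - x1 (tau m) ^+ 2) by rewrite mulr_gt0//; lra.
  by move: H; lra.
(* A single arc, then of type [Y], would end with [x1 ^ 2 <= 1] and miss the target. *)
split=> //; case: (m) C lastY => // C; rewrite addbF => bT.
have := chain_first_q u10 u11 u21 E C (ltn0Sn 0).
by rewrite bT (ch_m C) (re_end E).1; lra.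
Qed.

(** With the acceleration at the rest point not directed outwards, that point is the outermost one
    of its arc. *)
Lemma rest_arc_le (R : realType) (v X q th : R) :
  0 < v -> X^-1 <= v * X ->
  (v * X - X^-1) * cos th = 2 * v * q - (v * X + X^-1) -> q <= X.
Proof.
move=> v0 d0 H.
have H1 : 0 <= (v * X - X^-1) * (1 - cos th) by rewrite mulr_ge0 ?subr_ge0// cos_le1.
have : 0 <= v * (X - q) by move: H H1; lra.
by rewrite pmulr_rge0// subr_ge0.
Qed.

Lemma chain_XY_time (R : realType) (gamma u1 u2 T : R) (u : R -> R) (l0 : R)
    (x1 x2 l1 l2 : R -> R) n tau :
  1 < gamma -> 0 < u1 -> u1 <= 1 / gamma ^+ 4 -> 1 <= u2 ->
  regular_extremal gamma u1 u2 T u l0 x1 x2 l1 l2 ->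
  chain l2 T false n.*2.+2 tau ->
  exists sg s : R,
    [/\ (sg = 1 \/ sg = -1),
        0 < s <= Num.min ((1 - u1) ^+ 2 / 4)
                         ((u2 * gamma ^+ 2 - 1 / gamma ^+ 2) ^+ 2 / 4),
        transcendental_XY gamma u1 u2 sg s n
      & T = time_I1 u1 sg s + n%:R * (time_X u1 s + time_Y u2 s)
            + time_F gamma u2 s].
Proof.
move=> g1 u10 u1g u21 E C.
have [u11 ug] := gamma_u1 g1 u10 u1g.
have u20 : 0 < u2 by lra.
have g2 : 1 < gamma ^+ 2 by rewrite expr2; nra.
have gi1 : (gamma ^+ 2)^-1 < 1 by rewrite invf_lt1//; lra.
have gn : gamma ^+ 2 != 0 by rewrite gt_eqF//; lra.
pose s := slope x1 x2 (tau 1%N) ^+ 2.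
have s0 : 0 <= s by exact: sqr_ge0.
have [F1 F2 F3] := chain_first u10 u20 E C isT.
have bL : false (+) odd n.*2.+1 = true by rewrite /= odd_double.
have [L1 L2 L3] := chain_last u10 u20 E C.
rewrite bL /= in F1 F2 F3 L1 L2 L3.
have sL : slope x1 x2 (tau n.*2.+1) ^+ 2 = s.
  by apply: (chain_sqr u10 u20 E C); rewrite /= ltnSn.
(* The last switching has index [1 + 2 n]: it comes [n] pairs [YX] after the first. *)
have [Q tL] := chain_YX_iter (i := 1) (k := n) u10 u20 E C isT (ltnSn _) erefl.
rewrite !add1n -/s in Q tL.
rewrite -/s in F3; rewrite sL in L3.
have := chain_first_q u10 u11 u21 E C isT; rewrite /= => q11.
set q1 := x1 (tau 1%N) ^+ 2 in F2 F3 Q q11.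
set qL := x1 (tau n.*2.+1) ^+ 2 in L2 L3 Q.
have dL : 0 < u2 * gamma ^+ 2 - (gamma ^+ 2)^-1 by nra.
have rho1 : 1 <= (s + u2) / (s + u1).
  by rewrite ler_pdivlMr ?ltr_wpDl// mul1r lerD2l; lra.
have rhon : 1 <= ((s + u2) / (s + u1)) ^+ n by exact: exprn_ege1.
have qL1 : q1 <= qL by rewrite Q ler_peMr//; lra.
have qLg : qL <= gamma ^+ 2.
  by apply: (rest_arc_le u20 _ L2); lra.
(* For [s = 0] the energy relation leaves [q1 = 1], against [1 < q1], or [q1 = 1 / u1 >= gamma ^ 4],
   against [q1 <= qL <= gamma ^ 2]. *)
have spos : 0 < s.
  rewrite lt_neqAle s0 andbT; apply/eqP => s00.
  have : (u1 * q1 - 1) * (q1 - 1) = 0.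
    have q1n : q1 != 0 by rewrite gt_eqF//; lra.
    have := F3; rewrite -s00 add0r => H.
    have -> : (u1 * q1 - 1) * (q1 - 1) = q1 * (u1 * q1 + q1^-1 - (u1 + 1)) by field.
    by rewrite H subrr mulr0.
  move/eqP; rewrite mulf_eq0 !subr_eq0 => /orP[/eqP H|/eqP H]; last by lra.
  have : u1 * q1 <= u1 * gamma ^+ 2 by rewrite ler_pM2l//; lra.
  by lra.
have q10 : 0 < q1 by lra.
have qL0 : 0 < qL by lra.
have F1' : 0 <= 2 * Num.sqrt u1 * tau 1%N <= pi by lra.
have L1' : 0 <= 2 * Num.sqrt u2 * (T - tau n.*2.+1) <= pi by lra.
have F2' : (u1 * 1 - 1^-1) * cos (2 * Num.sqrt u1 * tau 1%N) = 2 * u1 * q1 - (u1 *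
    1 + 1^-1).
  by rewrite mulr1 invr1.
have F3' : (s + u1) * q1 + q1^-1 = u1 * 1 + 1^-1 by rewrite mulr1 invr1.
have [z1E d1E _ T1] := rest_time u10 spos q10 (oner_neq0 R) F1' F2' F3'.
rewrite !mulr1 !invr1 -/(c_init u1) in z1E d1E T1.
have [zLE dLE TL _] := rest_time u20 spos qL0 gn L1' L2 L3.
rewrite -/(c_fin gamma u2) in zLE TL.
set z1 := 2 * (s + u1) * q1 - c_init u1 in z1E d1E T1.
set zL := 2 * (s + u2) * qL - _ in zLE dLE TL.
(* [zL] is [(s + u2) qL - 1 / qL], and [1 < q1 <= qL]; this settles the sign of the root in
   [time_F]. *)
have zL0 : 0 <= zL.
  rewrite /zL -/(c_fin gamma u2) -L3.
  have -> : 2 * (s + u2) * qL - ((s + u2) * qL + qL^-1) = (s + u2) * qL - qL^-1 by ring.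
  rewrite subr_ge0; apply: (@le_trans _ _ 1); first by rewrite invf_le1//; lra.
  by apply: mulr_ege1; lra.
(* The choice of sign is that of [z1], which tells the two possible roots [q1] apart. *)
have [sg sg1 sgE] := sign_sqrt_sqr z1.
exists sg, s; split=> //.
- rewrite spos andTb le_min !ler_pdivlMr ?ltr0n// div1r; apply/andP; split.
    by rewrite -(sqrrN (1 - u1)) opprB d1E; have := sqr_ge0 z1; lra.
  by rewrite dLE; have := sqr_ge0 zL; lra.
- rewrite /transcendental_XY zLE z1E sgE sqrtr_sqr ger0_norm//.
  (* The two sides of the fraction are [2 (s + u2) qL] and [2 (s + u1) q1]; besides [qL / q1] this
     contributes one more factor [(s + u2) / (s + u1)], hence the exponent [n + 1]. *)
  have -> : c_fin gamma u2 + zL = 2 * (s + u2) * qL by rewrite /zL /c_fin; ring.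
  have -> : c_init u1 + z1 = 2 * (s + u1) * q1 by rewrite /z1; ring.
  rewrite Q [RHS]exprS; move: (_ ^+ n) => Y.
  have n1 : s + u1 != 0 by rewrite gt_eqF// ltr_wpDl.
  have n2 : q1 != 0 by rewrite gt_eqF.
  by field; rewrite ?n1 ?n2.
- have -> : T = tau 1%N + (tau n.*2.+1 - tau 1%N) + (T - tau n.*2.+1) by ring.
  have -> : tau n.*2.+1 - tau 1%N = n%:R * (time_X u1 s + time_Y u2 s).
    by rewrite tL addrAC subrr add0r.
  congr (_ + _ + _).
    have d1 : u1 - 1 < 0 by lra.
    by rewrite (time_of_angle u10 (T1 d1)) /time_I1 z1E [sg * (u1 * _)]mulrCA sgE.
  by rewrite (time_of_angle u20 (TL dL)) /time_F zLE sqrtr_sqr ger0_norm.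
Qed.

(** Here [n] counts the pairs [YX] after the initial [Y] and [X], so the chain belongs to
    [word_YXY n.+1]. *)
Lemma chain_YXY_time (R : realType) (gamma u1 u2 T : R) (u : R -> R) (l0 : R)
    (x1 x2 l1 l2 : R -> R) n tau :
  1 < gamma -> 0 < u1 -> u1 <= 1 / gamma ^+ 4 -> 1 <= u2 ->
  regular_extremal gamma u1 u2 T u l0 x1 x2 l1 l2 ->
  chain l2 T true n.*2.+3 tau ->
  exists sg s : R,
    [/\ (sg = 1 \/ sg = -1),
        0 < s <= (u2 - 1) ^+ 2 / 4,
        transcendental_YXY gamma u1 u2 sg s n.+1
      & T = time_I2 u2 sg s + n.+1%:R * time_X u1 s
            + (n.+1%:R - 1) * time_Y u2 s + time_F gamma u2 s].
Proof.
move=> g1 u10 u1g u21 E C.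
have [u11 ug] := gamma_u1 g1 u10 u1g.
have u20 : 0 < u2 by lra.
have g2 : 1 < gamma ^+ 2 by rewrite expr2; nra.
have gi1 : (gamma ^+ 2)^-1 < 1 by rewrite invf_lt1//; lra.
have gn : gamma ^+ 2 != 0 by rewrite gt_eqF//; lra.
pose s := slope x1 x2 (tau 1%N) ^+ 2.
have s0 : 0 <= s by exact: sqr_ge0.
have [F1 F2 F3] := chain_first u10 u20 E C isT.
have bL : true (+) odd n.*2.+2 = true by rewrite /= odd_double.
have [L1 L2 L3] := chain_last u10 u20 E C.
rewrite bL /= in F1 F2 F3 L1 L2 L3.
have sL : slope x1 x2 (tau n.*2.+2) ^+ 2 = s.
  by apply: (chain_sqr u10 u20 E C); rewrite /= ltnSn.
have [Q2 t2] := chain_X_arc u10 u20 E C (ltn0Sn 0) isT erefl.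
have [Q tL] := chain_YX_iter (i := 2) (k := n) u10 u20 E C isT (ltnSn _) erefl.
rewrite !add2n -/s in Q tL; rewrite -/s in Q2 t2.
rewrite -/s in F3; rewrite sL in L3.
have := chain_first_q u10 u11 u21 E C isT; rewrite /= => q11.
have q10 : 0 < x1 (tau 1%N) ^+ 2 by rewrite exprn_gt0// (re_x1_gt0 E).
have qL0 : 0 < x1 (tau n.*2.+2) ^+ 2 by rewrite exprn_gt0// (re_x1_gt0 E).
set q1 := x1 (tau 1%N) ^+ 2 in F2 F3 Q2 q11 q10.
set qL := x1 (tau n.*2.+2) ^+ 2 in L2 L3 Q qL0.
rewrite {}Q2 in Q.
have q1n : q1 != 0 by rewrite gt_eqF.
have su1 : 0 < s + u1 by rewrite ltr_wpDl.
have su2 : 0 < s + u2 by rewrite ltr_wpDl.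
have dL : 0 < u2 * gamma ^+ 2 - (gamma ^+ 2)^-1 by nra.
have rho1 : 1 <= (s + u2) / (s + u1).
  by rewrite ler_pdivlMr// mul1r lerD2l; lra.
have rhon : 1 <= ((s + u2) / (s + u1)) ^+ n by exact: exprn_ege1.
have qL1 : 1 <= qL * ((s + u1) * q1).
  rewrite Q mulrAC mulVf ?mul1r//.
  by rewrite mulf_neq0// gt_eqF.
have qLg : qL <= gamma ^+ 2.
  by apply: (rest_arc_le u20 _ L2); lra.
(* For [s = 0], [qL1] would give [1 <= u1 qL q1 <= u1 gamma ^ 2], whereas
   [u1 gamma ^ 2 <= 1 / gamma ^ 2 < 1]. *)
have spos : 0 < s.
  rewrite lt_neqAle s0 andbT; apply/eqP => s00.
  have : qL * ((s + u1) * q1) <= gamma ^+ 2 * u1.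
    have E1 : (s + u1) * q1 <= u1 by rewrite -s00 add0r ger_pMr.
    have E2 : 0 <= (s + u1) * q1 by rewrite mulr_ge0 ?ltW.
    by apply: ler_pM => //; exact: ltW.
  by lra.
have F1' : 0 <= 2 * Num.sqrt u2 * tau 1%N <= pi by lra.
have L1' : 0 <= 2 * Num.sqrt u2 * (T - tau n.*2.+2) <= pi by lra.
have F2' : (u2 * 1 - 1^-1) * cos (2 * Num.sqrt u2 * tau 1%N) = 2 * u2 * q1 - (u2 *
    1 + 1^-1).
  by rewrite mulr1 invr1.
have F3' : (s + u2) * q1 + q1^-1 = u2 * 1 + 1^-1 by rewrite mulr1 invr1.
have [z1E d1E T1 _] := rest_time u20 spos q10 (oner_neq0 R) F1' F2' F3'.
rewrite !mulr1 !invr1 -/(c_init u2) in z1E d1E T1.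
have [zLE dLE TL _] := rest_time u20 spos qL0 gn L1' L2 L3.
rewrite -/(c_fin gamma u2) in zLE TL.
set z1 := 2 * (s + u2) * q1 - c_init u2 in z1E d1E T1.
set zL := 2 * (s + u2) * qL - _ in zLE dLE TL.
(* For [u2 = 1] the starting point would be an equilibrium of the first arc, and [d1E] would read
   [0 = z1 ^ 2 + 4 s] with [s > 0]. *)
have d1 : 0 < u2 - 1.
  rewrite lt_neqAle eq_sym subr_ge0 u21 andbT; apply/eqP => d10.
  by move: d1E; rewrite d10 expr0n /=; have := sqr_ge0 z1; lra.
(* [qL] and [q1] are mapped by [q |-> (s + u2) q + 1 / q] to [c] and [c2], with
   [c2 < c]; together with [(s + u2) qL q1 > 1] this forces [q1 < qL]. *)
have SqL : 1 < (s + u2) * qL * q1.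
  apply: (le_lt_trans qL1).
  have : 0 < (u2 - u1) * (qL * q1) by apply: mulr_gt0; [lra|exact: mulr_gt0].
  by lra.
have q1L : q1 < qL.
  have cc : c_init u2 < c_fin gamma u2.
    rewrite /c_init /c_fin.
    have -> : u2 * gamma ^+ 2 + gamma ^- 2 =
        u2 + 1 + (gamma ^+ 2 - 1) * (u2 - (gamma ^+ 2)^-1).
      by field; rewrite gt_eqF//; lra.
    by rewrite ltrDl; apply: mulr_gt0; lra.
  have : 0 < (qL - q1) * ((s + u2) * qL * q1 - 1).
    have -> : (qL - q1) * ((s + u2) * qL * q1 - 1) =
        (((s + u2) * qL + qL^-1) - ((s + u2) * q1 + q1^-1)) * (qL * q1).
      by field; rewrite q1n gt_eqF.
    by rewrite L3 F3; apply: mulr_gt0; [rewrite subr_gt0|exact: mulr_gt0].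
  by rewrite pmulr_lgt0 subr_gt0.
have zL0 : 0 <= zL.
  rewrite /zL -/(c_fin gamma u2) -L3.
  have -> : 2 * (s + u2) * qL - ((s + u2) * qL + qL^-1) = (s + u2) * qL - qL^-1 by ring.
  rewrite subr_ge0 -(ler_pM2r qL0) mulVf ?gt_eqF//.
  apply: (le_trans (ltW SqL)); apply: ler_wpM2l; last exact: ltW.
  by apply: mulr_ge0; exact: ltW.
have [sg sg1 sgE] := sign_sqrt_sqr z1.
exists sg, s; split=> //.
- rewrite spos andTb ler_pdivlMr ?ltr0n// d1E; have := sqr_ge0 z1; lra.
- rewrite /transcendental_YXY zLE z1E sgE sqrtr_sqr ger0_norm//.
  have -> : c_fin gamma u2 + zL = 2 * (s + u2) * qL by rewrite /zL /c_fin; ring.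
  (* The unpaired [X]-arc inverts [q1], so [1 / q1] has to appear here; as
     [c2 = (s + u2) q1 + 1 / q1], this is where the sign before the root in the denominator becomes
     opposite to that of the other form. *)
  have -> : c_init u2 - z1 = 2 / q1 by rewrite /z1 /c_init -F3; field.
  rewrite Q [RHS]exprS; move: (_ ^+ n) => Y.
  have n1 : s + u1 != 0 by rewrite gt_eqF.
  by field; rewrite ?n1 ?q1n.
- have -> : T = tau 1%N + (tau n.*2.+2 - tau 1%N) + (T - tau n.*2.+2) by ring.
  have -> : tau n.*2.+2 - tau 1%N = time_X u1 s + n%:R * (time_X u1 s + time_Y u2 s).
    by rewrite tL -t2; ring.
  rewrite (time_of_angle u20 (TL dL)) /time_F zLE sqrtr_sqr (ger0_norm zL0).
  rewrite {1}(time_of_angle u20 (T1 d1)) /time_I2 z1E [sg * (u2 * _)]mulrCA sgE.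
  by rewrite -natr1; ring.
Qed.

(** * Words of segments *)

Lemma size_XYs n : size (flatten (nseq n [:: segX; segY])) = n.*2.
Proof. by elim: n => //= n ->. Qed.

Lemma nth_XYs n i : (i < n.*2)%N ->
  nth segX (flatten (nseq n [:: segX; segY])) i = if odd i then segY else segX.
Proof.
elim: n i => // n IHn [|[|i]] //; rewrite doubleS !ltnS => i_lt.
by rewrite /= IHn // negbK.
Qed.

Lemma size_word_XY n : size (word_XY n) = n.*2.+2.
Proof. by rewrite /word_XY size_XYs. Qed.

Lemma nth_word_XY n i : (i < size (word_XY n))%N ->
  nth segX (word_XY n) i = if false (+) odd i then segY else segX.
Proof. by rewrite size_word_XY => i_lt; rewrite addFb nth_XYs. Qed.

Lemma size_word_YXY n : size (word_YXY n) = n.*2.+1.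
Proof. by rewrite /= size_XYs. Qed.

Lemma nth_word_YXY n i : (i < size (word_YXY n))%N ->
  nth segX (word_YXY n) i = if true (+) odd i then segY else segX.
Proof.
rewrite size_word_YXY; case: i => // i; rewrite ltnS => i_lt.
by rewrite /= nth_XYs // negbK.
Qed.

Lemma has_form_chain (R : realType) (gamma u1 u2 T : R) (u : R -> R) (l0 : R)
    (x1 x2 l1 l2 : R -> R) b w :
  u1 < u2 -> regular_extremal gamma u1 u2 T u l0 x1 x2 l1 l2 ->
  (forall i, (i < size w)%N ->
    nth segX w i = if b (+) odd i then segY else segX) ->
  has_form u1 u2 T u w -> exists tau, chain l2 T b (size w) tau.
Proof.
move=> u12 E wE [tau [t0 tT tlt tu]]; exists tau.
apply: (control_chain u12 E) => // i iw.
by move: (tu i iw); rewrite wE// /ctl; case: (_ (+) _).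
Qed.

Lemma chain_has_form (R : realType) (gamma u1 u2 T : R) (u : R -> R) (l0 : R)
    (x1 x2 l1 l2 : R -> R) b w tau :
  regular_extremal gamma u1 u2 T u l0 x1 x2 l1 l2 ->
  (forall i, (i < size w)%N ->
    nth segX w i = if b (+) odd i then segY else segX) ->
  chain l2 T b (size w) tau -> has_form u1 u2 T u w.
Proof.
move=> E wE C; exists tau; split.
- exact: (ch_0 C).
- exact: (ch_m C).
- exact: (ch_lt C).
- move=> i iw; have := chain_control E C iw.
  by rewrite wE// /ctl; case: (_ (+) _).
Qed.


Theorem theorem2 (R : realType) (gamma u1 u2 : R)
    (hgamma : 1 < gamma)
    (hu1_gt0 : 0 < u1) (hu1 : u1 <= 1 / gamma ^+ 4)
    (hgamma4 : 1 / gamma ^+ 4 < 1) (hu2 : 1 <= u2)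
    (T : R) (x1 x2 u : R -> R)
    (hext : extremal gamma u1 u2 T x1 x2 u) :
  ((exists n : nat, has_form u1 u2 T u (word_XY n)) \/
   (exists n : nat, (1 <= n)%N /\ has_form u1 u2 T u (word_YXY n))) /\
  (forall n : nat, has_form u1 u2 T u (word_XY n) ->
     exists sg s : R,
       [/\ (sg = 1 \/ sg = -1),
           0 < s <= Num.min ((1 - u1) ^+ 2 / 4)
                            ((u2 * gamma ^+ 2 - 1 / gamma ^+ 2) ^+ 2 / 4),
           transcendental_XY gamma u1 u2 sg s n
         & T = time_I1 u1 sg s + n%:R * (time_X u1 s + time_Y u2 s)
               + time_F gamma u2 s]) /\
  (forall n : nat, (1 <= n)%N -> has_form u1 u2 T u (word_YXY n) ->
     exists sg s : R,
       [/\ (sg = 1 \/ sg = -1),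
           0 < s <= (u2 - 1) ^+ 2 / 4,
           transcendental_YXY gamma u1 u2 sg s n
         & T = time_I2 u2 sg s + n%:R * time_X u1 s
               + (n%:R - 1) * time_Y u2 s + time_F gamma u2 s]).
Proof.
have [u11 _] := gamma_u1 hgamma hu1_gt0 hu1.
have u12 : u1 < u2 by lra.
have [l0 [y1 [y2 [l1 [l2 E]]]]] := extremal_regular hu1_gt0 (ltW u12) hext.
split; last split.
- have [b [[|m] [tau C]]] := chain_exists E.
    have T0 : T = 0 by rewrite -(ch_m C) (ch_0 C).
    by have := (re_end E).1; rewrite T0 (re_start E).1; lra.
  have [bm m0] := chain_last_Y hgamma hu1_gt0 hu1 hu2 E C.
  (* There are [m + 1] arcs and the last is of type [Y], so the type of the first fixes the parity
     of [m]. *)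
  case: b bm C => bm C; [right|left]; exists m./2.
    have mE : m = m./2.*2 by rewrite even_halfK//; move: bm; case: (odd m).
    split; first by rewrite half_gt0; case: (m) mE m0 => [|[]].
    apply: (chain_has_form (tau := tau) E (@nth_word_YXY _)).
    by rewrite size_word_YXY -mE.
  have mE : m = m./2.*2.+1 by rewrite odd_halfK//; case: (m) m0.
  apply: (chain_has_form (tau := tau) E (@nth_word_XY _)).
  by rewrite size_word_XY -mE.
- move=> n /(has_form_chain u12 E (@nth_word_XY n)) [tau].
  by rewrite size_word_XY => C; exact: (chain_XY_time hgamma hu1_gt0 hu1 hu2 E C).
- move=> [//|n] _ /(has_form_chain u12 E (@nth_word_YXY _)) [tau].
  by rewrite size_word_YXY => C; exact: (chain_YXY_time hgamma hu1_gt0 hu1 hu2 E C).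
Qed.
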